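(* Let $(\Omega,d)$ be an unbounded uniform domain with uniformity constant $C_U$, and let $\varphi:(0,\infty)\to(0,\infty)$ be a dampening function with constant $C_\varphi$. Let $d_\varphi$, $\Omega_\varphi=\Omega\cup\{\infty\}$ and $\partial\Omega_\varphi$ be as defined in the context. Then $\Omega_\varphi$, equipped with the metric $d_\varphi$, is a uniform domain with $\partial\Omega_\varphi=\partial\Omega$, and with uniformity constant depending only on $C_\varphi$ and $C_U$. Furthermore, the natural identity map $I:(\Omega,d)\to(\Omega_\varphi\setminus\{\infty\},d_\varphi)$ is a local bi-Lipschitz map, and it is also uniformly locally bi-Lipschitz near $\partial\Omega$. If $(\Omega,d)$ is a length space, then $I$ is a local isometry near $\partial\Omega$.
   Context: For a metric space $(X,\rho)$ let $\overline X$ be its completion and $\partial X:=\overline X\setminus X$. The space $(X,\rho)$ is a uniform domain if it is locally compact and non-complete and there is a constant $C\ge 1$ (a uniformity constant) such that every pair of distinct points $x,y\in X$ can be joined by a $C$-uniform curve, i.e. a curve $\gamma$ in $X$ with end points $x,y$ such that its length satisfies $\ell_\rho(\gamma)\le C\rho(x,y)$ and, for every $z$ in the trajectory of $\gamma$, $\min\{\ell_\rho(\gamma_{x,z}),\ell_\rho(\gamma_{z,y})\}\le C\,\mathrm{dist}_\rho(z,\partial X)$, where $\gamma_{a,b}$ denotes the subcurve of $\gamma$ between $a$ and $b$. Standing assumptions: $(\Omega,d)$ is an unbounded uniform domain; its uniformity constant $C_U$ is chosen so that subcurves of the uniform curves used are also $C_U$-uniform. Dampening function: $\varphi:(0,\infty)\to(0,\infty)$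 is continuous and monotone decreasing (non-increasing), $\varphi(t)=1$ for $0<t\le 1$, $\int_0^\infty\varphi(t)\,dt<\infty$, and $C_\varphi\ge 1$ is a constant with $\varphi(t)\le C_\varphi\,\varphi(2t)$ for all $t>0$. For $x\in\Omega$ let $d_\Omega(x)=\mathrm{dist}_d(x,\partial\Omega)$. For $x,y\in\Omega$ set $d_\varphi(x,y):=\inf_\gamma\int_\gamma\varphi\circ d_\Omega\,ds$, the infimum being over all $d$-rectifiable curves $\gamma$ in $\Omega$ with end points $x,y$, and $ds$ being arc length with respect to $d$. The metric $d_\varphi$ extends to a metric on $\Omega\cup\partial\Omega$ by taking limits along sequences in $\Omega$ that $d$-converge to points of $\partial\Omega$. Let $\overline{\Omega\cup\partial\Omega}^{\varphi}$ be the completion of $\Omega\cup\partial\Omega$ with respect to $d_\varphi$, and $\Omega_\varphi:=\overline{\Omega\cup\partial\Omega}^{\varphi}\setminus\partial\Omega$, with the extended metric $d_\varphi$. One has $\Omega_\varphi=\Omega\cup\{\infty\}$, where $\infty$ is the single point represented by $d_\varphi$-Cauchy sequences in $\Omega$ that are not $d$-Cauchy. $\partial\Omega_\varphi$ is the completion of $(\Omega_\varphi,d_\varphi)$ minus $\Omega_\varphi$. Terminology: a map is local bi-Lipschitz if every point has a neighborhood on which the map is bi-Lipschitz onto its image. $I$ is uniformly locally bi-Lipschitz near $\partial\Omega$ if there are $r>0$ and $L\ge 1$ such that for each $\zeta\in\partial\Omega$ the restriction of $I$ to $\{x\in\Omega: d(x,\zeta)<r\}$ is $L$-bi-Lipschitz.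 $I$ is a local isometry near $\partial\Omega$ if there is $r>0$ such that for each $\zeta\in\partial\Omega$ the restriction of $I$ to $\{x\in\Omega: d(x,\zeta)<r\}$ is an isometry onto its image.
   Formalization: Local compactness of Ω_φ at ∞ is claimed only when ∂Ω is bounded (it fails for the half plane with φ(t)=min(1,t⁻²)); local compactness elsewhere and all other clauses of ''uniform domain'' are proved for every ∂Ω. *)

(* Defs.v *)
From HB Require Import structures.
From mathcomp Require Import all_boot all_order all_algebra.
From mathcomp Require Import all_classical all_reals all_analysis.
From mathcomp Require Import ring.
Set Implicit Arguments.
Unset Strict Implicit.
Unset Printing Implicit Defensive.
Import Order.TTheory GRing.Theory Num.Theory.
Import numFieldTopology.Exports numFieldNormedType.Exports.
Import metricType_numDomainType.
Local Open Scope classical_set_scope.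
Local Open Scope ring_scope.
Local Open Scope quotient_scope.

Section SubspaceMetric.
Context {R : realType} {X : metricType R} (A : set X).

Let sub_dist (x y : A) : R := mdist (set_val x) (set_val y).

Let sub_dist_ge0 x y : 0 <= sub_dist x y.
Proof. exact: mdist_ge0. Qed.

Let sub_dist_positivity x y : sub_dist x y = 0 -> x = y.
Proof. by move=> /mdist_positivity /val_inj. Qed.

Let sub_ballE (x : A) d : ball x d = [set y | sub_dist x y < d].
Proof.
apply/seteqP; split => y /=; rewrite /sub_dist;
  have -> : ball x d y = ball (set_val x) d (set_val y) by [];
  by rewrite ballEmdist.
Qed.

HB.instance Definition _ := PseudoMetric_isMetric.Build R (set_type A)
  sub_dist_ge0 sub_dist_positivity sub_ballE.

End SubspaceMetric.

Section Completion.
Context {R : realType} (X : metricType R).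

Definition cauchy_seq := {u : nat -> X | `[< cauchy (u @ \oo) >]}.


Definition cs_dist (u v : cauchy_seq) : R :=
  lim (mdist (sval u n) (sval v n) @[n --> \oo]).

Lemma cauchy_seqP (u : nat -> X) :
  cauchy (u @ \oo) <->
  forall e : R, 0 < e -> exists N, forall m n, (N <= m)%N -> (N <= n)%N ->
    mdist (u m) (u n) < e.
Proof.
split=> [/cauchy_ballP uC e e0|uC].
  have [[A B] /= [[N1 _ AN] [N2 _ BN]] AB] := uC e e0.
  exists (maxn N1 N2) => m n; rewrite !geq_max => /andP[m1 m2] /andP[n1 n2].
  have := AB (u m, u n) (conj (AN _ m1) (BN _ n2)).
  by rewrite /= ballEmdist.
apply/cauchy_ballP => e e0; have [N NP] := uC e e0.
exists (u @` [set n | (N <= n)%N], u @` [set n | (N <= n)%N]) => /=.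
  by split; exists N => // n /= Nn; exists n.
by move=> [_ _] /= [[m Nm <-] [n Nn <-]]; rewrite ballEmdist /=; exact: NP.
Qed.

Lemma mdist_lip (x y z t : X) :
  `|mdist x y - mdist z t| <= mdist x z + mdist y t.
Proof.
rewrite ler_norml; apply/andP; split.
  rewrite lerNl opprB lerBlDr (le_trans (metric_triangle _ x _))//.
  rewrite (metric_sym z) -addrA lerD2l [leRHS]addrC.
  exact: metric_triangle.
rewrite lerBlDr (le_trans (metric_triangle _ z _))// -addrA lerD2l addrC.
by rewrite (metric_sym y) metric_triangle.
Qed.

Lemma cs_dist_cvg (u v : cauchy_seq) :
  cvg (mdist (sval u n) (sval v n) @[n --> \oo]).
Proof.
have /asboolP/cauchy_seqP uC := svalP u; have /asboolP/cauchy_seqP vC := svalP v.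
apply/cauchy_cvgP/cauchy_ballP => e e0.
have e2 : 0 < e / 2 by rewrite divr_gt0.
have [M MP] := uC _ e2; have [N NP] := vC _ e2.
pose I := [set n | (maxn M N <= n)%N].
pose d n := mdist (sval u n) (sval v n).
exists (d @` I, d @` I) => /=; first by split; exists (maxn M N) => // n ?; exists n.
move=> [_ _] /= [[m + <-] [n + <-]]; rewrite /I /= !geq_max.
move=> /andP[m1 m2] /andP[n1 n2]; rewrite /ball /= /d.
by rewrite (le_lt_trans (mdist_lip _ _ _ _))// (splitr e) ltrD ?MP ?NP.
Qed.

Lemma cs_dist_ge0 u v : 0 <= cs_dist u v.
Proof.
by apply: limr_ge; [exact: cs_dist_cvg|apply: nearW => n; exact: mdist_ge0].
Qed.

Lemma cs_distxx u : cs_dist u u = 0.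
Proof.
apply: cvg_lim => //; under eq_fun do rewrite mdistxx.
exact: cvg_cst.
Qed.

Lemma cs_dist_sym u v : cs_dist u v = cs_dist v u.
Proof. by rewrite /cs_dist; under eq_fun do rewrite metric_sym. Qed.

Lemma cs_dist_triangle v u w : cs_dist u w <= cs_dist u v + cs_dist v w.
Proof.
rewrite /cs_dist -limD; [|exact: cs_dist_cvg|exact: cs_dist_cvg].
apply: ler_lim; [exact: cs_dist_cvg|by apply: is_cvgD; exact: cs_dist_cvg|].
by apply: nearW => n; exact: metric_triangle.
Qed.

Definition cs_equiv (u v : cauchy_seq) := cs_dist u v == 0.

Let cs_equiv_refl : reflexive cs_equiv.
Proof. by move=> u; rewrite /cs_equiv cs_distxx. Qed.

Let cs_equiv_sym : symmetric cs_equiv.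
Proof. by move=> u v; rewrite /cs_equiv cs_dist_sym. Qed.

Let cs_equiv_trans : transitive cs_equiv.
Proof.
move=> v u w /eqP uv /eqP vw; rewrite /cs_equiv eq_le cs_dist_ge0 andbT.
by rewrite (le_trans (cs_dist_triangle v _ _))// uv vw addr0.
Qed.

Canonical cs_equiv_rel :=
  EquivRel cs_equiv cs_equiv_refl cs_equiv_sym cs_equiv_trans.

Definition completion := {eq_quot cs_equiv_rel}.

HB.instance Definition _ := Choice.on completion.
HB.instance Definition _ := EqQuotient.on completion.

Let cdist (p q : completion) : R := cs_dist (repr p) (repr q).

Let cdistxx p : cdist p p = 0.
Proof. exact: cs_distxx. Qed.

Let cdist_positivity p q : cdist p q = 0 -> p = q.
Proof.
move=> pq0; rewrite -[p]reprK -[q]reprK; apply/eqmodP.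
by rewrite /= /cs_equiv -/(cdist p q) pq0.
Qed.

Let cdist_sym p q : cdist p q = cdist q p.
Proof. exact: cs_dist_sym. Qed.

Let cdist_triangle q p r : cdist p r <= cdist p q + cdist q r.
Proof. exact: cs_dist_triangle. Qed.

HB.instance Definition _ := isMetric.Build R completion
  cdistxx cdist_positivity cdist_sym cdist_triangle.

Lemma mdist_pi (u v : cauchy_seq) :
  mdist (\pi_completion u) (\pi_completion v) = cs_dist u v.
Proof.
have E (w : cauchy_seq) : cs_dist w (repr (\pi_completion w)) = 0.
  by have /eqmodP/eqP := esym (reprK (\pi_completion w)).
rewrite /mdist /= /cdist; apply/eqP; rewrite eq_le; apply/andP; split.
  rewrite (le_trans (cs_dist_triangle u _ _))// cs_dist_sym E add0r.
  by rewrite (le_trans (cs_dist_triangle v _ _))// E addr0.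
rewrite (le_trans (cs_dist_triangle (repr (\pi_completion u)) _ _))// E add0r.
rewrite (le_trans (cs_dist_triangle (repr (\pi_completion v)) _ _))//.
by rewrite (cs_dist_sym _ v) E addr0.
Qed.

Let cst_cauchy (x : X) : `[< cauchy ((fun _ : nat => x) @ \oo) >].
Proof.
by apply/asboolP/cauchy_seqP => e e0; exists 0%N => m n _ _; rewrite mdistxx.
Qed.

Definition embed (x : X) : completion :=
  \pi_completion (exist _ (fun _ : nat => x) (cst_cauchy x)).

Lemma mdist_embed x y : mdist (embed x) (embed y) = mdist x y.
Proof.
rewrite mdist_pi /cs_dist /=; move: (mdist x y) => r.
exact: lim_cst.
Qed.

Lemma embed_inj : injective embed.
Proof.
by move=> x y xy; apply: mdist_positivity; rewrite -mdist_embed xy mdistxx.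
Qed.

Lemma embed_cvg (u : cauchy_seq) : embed (sval u n) @[n --> \oo] --> \pi_completion u.
Proof.
apply/cvgrPdist_le => e e0.
have /asboolP/cauchy_seqP/(_ _ e0)[N NP] := svalP u.
exists N => // n /= Nn; rewrite mdist_pi.
apply: limr_le; first exact: cs_dist_cvg.
by exists N => // m /= Nm; apply/ltW/NP.
Qed.

Lemma embed_dense (p : completion) (e : R) : 0 < e ->
  exists x, mdist p (embed x) < e.
Proof.
move=> e0; rewrite -[p]reprK.
have /cvgrPdist_lt/(_ _ e0)[N _ NP] := @embed_cvg (repr p).
by exists (sval (repr p) N); exact: NP (leqnn N).
Qed.

End Completion.

Section Complete.
Context {R : realType}.

Definition seq_complete (X : metricType R) :=
  forall u : nat -> X, cauchy (u @ \oo) -> exists l : X, u @ \oo --> l.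

Lemma completion_complete (X : metricType R) : seq_complete (completion X).
Proof.
move=> p /cauchy_seqP pC.
have H n : exists x : X, mdist (p n) (embed x) < n.+1%:R^-1.
  by apply: embed_dense; rewrite invr_gt0.
pose x n := sval (cid (H n)).
have xP n : mdist (p n) (embed (x n)) < n.+1%:R^-1 := svalP (cid (H n)).
have small (e : R) : 0 < e -> exists N, forall n, (N <= n)%N -> n.+1%:R^-1 < e.
  move=> e0; have [N _ NP] := near_infty_natSinv_lt (PosNum e0).
  by exists N.
have xC : cauchy (x @ \oo).
  apply/cauchy_seqP => e e0; have e3 : 0 < e / 3 by rewrite divr_gt0.
  have [N1 P1] := pC _ e3; have [N2 P2] := small _ e3.
  exists (maxn N1 N2) => m n; rewrite !geq_max => /andP[m1 m2] /andP[n1 n2].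
  rewrite -mdist_embed (le_lt_trans (metric_triangle _ (p m) _))//.
  rewrite metric_sym (_ : e = e / 3 + (e / 3 + e / 3)); last first.
    by field.
  rewrite ltrD//; first exact: lt_trans (xP _) (P2 _ m2).
  rewrite (le_lt_trans (metric_triangle _ (p n) _))// ltrD//; first exact: P1.
  exact: lt_trans (xP _) (P2 _ n2).
have xC' : `[< cauchy (x @ \oo) >] by exact/asboolP.
exists (\pi_(completion X) (exist _ x xC')).
have /cvgrPdist_lt xl := @embed_cvg _ _ (exist _ x xC').
apply/cvgrPdist_lt => e e0; have e2 : 0 < e / 2 by rewrite divr_gt0.
have [N1 _ P1] := xl _ e2; have [N2 P2] := small _ e2.
exists (maxn N1 N2) => // n /=; rewrite geq_max => /andP[n1 n2].
rewrite (le_lt_trans (metric_triangle _ (embed (x n)) _))// (splitr e) ltrD//.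
  exact: P1.
by rewrite metric_sym (lt_trans (xP _) (P2 _ n2)).
Qed.

End Complete.

Section UniformDomain.
Context {R : realType}.

Definition boundary (X : metricType R) : set (completion X) :=
  ~` range (@embed R X).

Definition bdist (X : metricType R) (x : X) : R :=
  inf [set mdist (embed x) z | z in @boundary X].

Definition is_curve (X : metricType R) (g : R -> X) (a b : R) :=
  a <= b /\ {within `[a, b], continuous g}.

Definition joins (X : metricType R) (g : R -> X) (a b : R) (x y : X) :=
  [/\ is_curve g a b, g a = x & g b = y].

(* Same shape as numfun's variation, with mdist in place of the norm. *)
Definition curve_variation (X : metricType R) (g : R -> X) (a b : R)
    (s : seq R) : R :=
  let G := g \o nth b (a :: s) in
  \sum_(0 <= n < size s) mdist (G n) (G n.+1).

Definition curve_length (X : metricType R) (g : R -> X) (a b : R) : \bar R :=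
  ereal_sup [set (curve_variation g a b s)%:E | s in itv_partition a b].

(* The second condition is required at every parameter t, hence for both ways of
   cutting the curve at a point that it visits twice. *)
Definition uniform_curve (C : R) (X : metricType R) (g : R -> X) (a b : R) :=
  (curve_length g a b <= (C * mdist (g a) (g b))%:E)%E /\
  forall t, a <= t -> t <= b ->
    (Order.min (curve_length g a t) (curve_length g t b)
       <= (C * bdist (g t))%:E)%E.

Definition uniformly_connected (C : R) (X : metricType R) :=
  forall x y : X, x <> y ->
    exists (g : R -> X) (a b : R), joins g a b x y /\ uniform_curve C g a b.

(* All the requirements on a uniform domain except local compactness *)
Definition uniform_space (C : R) (X : metricType R) :=
  [/\ ~ seq_complete X, 1 <= C & uniformly_connected C X].

Definition uniform_domain (C : R) (X : metricType R) :=
  locally_compact [set: X] /\ uniform_space C X.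

(* The uniform curves can be chosen such that all their subcurves are uniform
   with the same constant. *)
Definition subcurve_uniform (C : R) (X : metricType R) :=
  forall x y : X, x <> y ->
    exists (g : R -> X) (a b : R), joins g a b x y /\
      forall s t, a <= s -> s <= t -> t <= b -> uniform_curve C g s t.

Definition metric_bounded (X : metricType R) (A : set X) :=
  exists M : R, forall x y, A x -> A y -> mdist x y <= M.

Definition length_space (X : metricType R) :=
  forall x y : X, (mdist x y)%:E =
    ereal_inf [set l | exists (g : R -> X) (a b : R),
                         joins g a b x y /\ l = curve_length g a b].

Definition bilipschitz_on (X Y : metricType R) (L : R) (A : set X)
    (f : X -> Y) :=
  forall x y, A x -> A y ->
    L^-1 * mdist x y <= mdist (f x) (f y) <= L * mdist x y.

Definition isometry_on (X Y : metricType R) (A : set X) (f : X -> Y) :=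
  forall x y, A x -> A y -> mdist (f x) (f y) = mdist x y.

Definition locally_bilipschitz (X Y : metricType R) (f : X -> Y) :=
  forall x : X, exists U : set X, nbhs x U /\
    exists L : R, 1 <= L /\ bilipschitz_on L U f.

Definition near_bdpoint (X : metricType R) (r : R) (z : completion X) :
    set X :=
  [set x | mdist (embed x) z < r].

Definition bilipschitz_near_boundary (X Y : metricType R) (f : X -> Y) :=
  exists r L : R, [/\ 0 < r, 1 <= L
    & forall z, @boundary X z -> bilipschitz_on L (near_bdpoint r z) f].

Definition isometry_near_boundary (X Y : metricType R) (f : X -> Y) :=
  exists r : R, 0 < r /\
    forall z, @boundary X z -> isometry_on (near_bdpoint r z) f.

End UniformDomain.

Section Dampening.
Context {R : realType}.
Local Notation mu := (@lebesgue_measure R).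

(* phi is only constrained on the positive reals. *)
Record dampening (phi : R -> R) (C : R) : Prop := {
  damp_gt0 : forall t, 0 < t -> 0 < phi t;
  damp_cont : forall t, 0 < t -> {for t, continuous phi};
  damp_mono : forall s t, 0 < s -> s <= t -> phi t <= phi s;
  damp_one : forall t, 0 < t -> t <= 1 -> phi t = 1;
  damp_int : (\int[mu]_(t in `]0%R, +oo[) (phi t)%:E < +oo)%E;
  damp_C : 1 <= C;
  damp_doubling : forall t, 0 < t -> phi t <= C * phi (2 * t) }.

(* The value does not depend on the choice of the parameter t, as g is constant
   between two admissible ones. *)
Definition arc_length_param (X : metricType R) (g : R -> X) (a b s : R) : X :=
  g (xget a [set t | a <= t <= b /\ curve_length g a t = s%:E]).

Definition line_integral (X : metricType R) (f : X -> R) (g : R -> X)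
    (a b : R) : R :=
  \int[mu]_(s in `[0, fine (curve_length g a b)])
    f (arc_length_param g a b s).

Definition dphi (X : metricType R) (phi : R -> R) (x y : X) : R :=
  inf [set r | exists (g : R -> X) (a b : R),
    [/\ joins g a b x y, (curve_length g a b < +oo)%E
      & r = line_integral (phi \o @bdist R X) g a b]].

(* The completion of X is X together with its boundary; D extends dphi to it
   by limits. The embedding of X being dense, D is determined by phi. *)
Definition extends_dphi (X : metricType R) (phi : R -> R)
    (D : completion X -> completion X -> R) :=
  forall (p q : completion X) (u v : nat -> X),
    embed (u n) @[n --> \oo] --> p -> embed (v n) @[n --> \oo] --> q ->
    dphi phi (u n) (v n) @[n --> \oo] --> D p q.

Record is_metric (T : Type) (D : T -> T -> R) : Prop := {
  ismetric_xx : forall x, D x x = 0;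
  ismetric_pos : forall x y, D x y = 0 -> x = y;
  ismetric_sym : forall x y, D x y = D y x;
  ismetric_triangle : forall y x z, D x z <= D x y + D y z }.

Definition metrized (T : choiceType) (D : T -> T -> R) (HD : is_metric D) :
  Type := T.

Section Metrized.
Variables (T : choiceType) (D : T -> T -> R) (HD : is_metric D).
HB.instance Definition _ := Choice.copy (metrized HD) T.
HB.instance Definition _ := isMetric.Build R (metrized HD)
  (ismetric_xx HD) (ismetric_pos HD) (ismetric_sym HD) (ismetric_triangle HD).
End Metrized.

Section OmegaPhi.
Context {X : metricType R} {D : completion X -> completion X -> R}.
Variable HD : is_metric D.

Definition phi_closure : metricType R := completion (metrized HD).

Definition old_boundary : set phi_closure :=
  [set embed (p : metrized HD) | p in @boundary R X].

Definition Omega_phi : metricType R := set_type (~` old_boundary).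

Lemma old_boundaryPn (x : X) :
  embed (embed x : metrized HD) \in ~` old_boundary.
Proof.
by rewrite inE => -[p pb /embed_inj px]; apply: pb; exists x.
Qed.

Definition to_phi (x : X) : Omega_phi :=
  exist _ (embed (embed x : metrized HD)) (old_boundaryPn x).

Definition is_infinity (infty : Omega_phi) :=
  [/\ exists u : nat -> X,
        cauchy (to_phi (u n) @[n --> \oo]) /\ ~ cauchy (u @ \oo),
      forall u : nat -> X,
        cauchy (to_phi (u n) @[n --> \oo]) -> ~ cauchy (u @ \oo) ->
        to_phi (u n) @[n --> \oo] --> infty
    & range to_phi = ~` [set infty]].

(* The canonical identification F of the completion of Omega_phi with
   phi_closure (unique, as Omega_phi is dense in its completion) carries the
   boundary of Omega_phi onto the boundary of Omega. *)
Definition same_boundary :=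
  exists F : completion Omega_phi -> phi_closure,
    [/\ bijective F, isometry_on [set: completion Omega_phi] F,
        forall y : Omega_phi, F (embed y) = set_val y
      & F @` @boundary R Omega_phi = old_boundary].

End OmegaPhi.

End Dampening.

(* Main.v *)
(* Write r = d_Omega(x) and Phi(u) = int_0^u phi. At arc length s along a curve
   issued from x, d_Omega is at most r + s, hence
     d_phi(x, y) >= Phi(r + d(x, y)) - Phi(r).
   On the first half of a C-uniform curve issued from x, d_Omega is at least
   max(s / C, r - s) >= (r + s) / (1 + 2 C), so by doubling the phi-length of its
   initial piece of length s is at most a constant times Phi(r + s) - Phi(r).
   As Phi is concave the two bounds match; as moreover dist_phi(z, bd Omega) is
   at least Phi(d_Omega(z)), a d-uniform curve is d_phi-uniform. Gluing halves of
   uniform curves of lengths 1, 1, 2, 4, ... gives rays along which d_Omega grows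
   linearly. Since Phi is bounded, all sequences with d_Omega -> oo have the same
   d_phi-limit, and the rays are d_phi-uniform curves to it. *)
Require Import Defs.
From mathcomp Require Import all_boot all_order all_algebra.
From mathcomp Require Import all_classical all_reals all_analysis.
From mathcomp Require Import ring lra.
Set Implicit Arguments.
Unset Strict Implicit.
Unset Printing Implicit Defensive.
Import Order.TTheory GRing.Theory Num.Theory.
Import numFieldTopology.Exports numFieldNormedType.Exports.
Local Open Scope classical_set_scope.
Local Open Scope ring_scope.

(** Three devices carry the estimates. Every curve is replaced by its arc length parametrization on
    an interval [[0, L]] ([unit_speed]), so that a line integral is an ordinary integral and curves
    can be cut, reversed and concatenated. The transport of curves is proved for any map [f] into a
    metric space that carries [dphi] to the metric and satisfies [Phi (bdist x) <= bdist (f x)],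
    before [Omega_phi] is at hand. A ray to infinity has infinite [d]-length; its image becomes a
    curve on a compact interval once it is parametrized by the values of [Phi] instead of arc
    length.

    The obstacle is compactness, as bounded closed sets away from the boundary are not assumed
    compact. At the points of Omega local compactness is inherited, since small [dphi]-balls lie in
    small [d]-balls. At infinity it rests on the compactness of the sets where [bdist] lies between
    two positive bounds; for a bounded boundary this follows from an argument of Hopf-Rinow type
    along uniform curves. *)

Section CurveLength.
Context {R : realType} {X : metricType R}.
Implicit Types (g : R -> X) (a b c s t : R).

Lemma curve_variation_cons g a b x p :
  curve_variation g a b (x :: p) = mdist (g a) (g x) + curve_variation g x b p.
Proof. by rewrite /curve_variation /= big_nat_recl. Qed.

Lemma curve_variation_cat g a b c p q : last a p = b ->
  curve_variation g a c (p ++ q) =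
  curve_variation g a b p + curve_variation g b c q.
Proof.
elim: p a => [a /= ->|x p ih a /= pb].
  by rewrite {2}/curve_variation big_nil add0r.
by rewrite !curve_variation_cons ih// addrA.
Qed.

(** The source of upper bounds on lengths: the increments of [F] telescope over every partition, so
    partitions never have to be refined. *)
Definition majorant g a b (F : R -> R) :=
  forall s t, a <= s -> s <= t -> t <= b -> mdist (g s) (g t) <= F t - F s.

Lemma curve_length_majorant g a b (F : R -> R) : majorant g a b F ->
  (curve_length g a b <= (F b - F a)%:E)%E.
Proof.
move=> Fg; apply: ge_ereal_sup => _ [p pab <-]; rewrite lee_fin.
elim: p a pab Fg => [a [_ /eqP /= ->] _|x p ih a /[dup] pab [/= /andP[ax _] _] Fg].
  by rewrite /curve_variation big_nil subrr.
have xpb := itv_partition_cons pab; have xb := itv_partition_le xpb.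
rewrite curve_variation_cons (_ : F b - F a = (F x - F a) + (F b - F x)); last by ring.
rewrite lerD ?(Fg _ _ (lexx a) (ltW ax) xb)//; apply: ih => // s t xs st tb.
by rewrite Fg// (le_trans (ltW ax)).
Qed.

Lemma mdist_le_curve_length g a b : a <= b ->
  ((mdist (g a) (g b))%:E <= curve_length g a b)%E.
Proof.
rewrite le_eqVlt => /predU1P[<-|ab].
  apply: ereal_sup_ubound; exists [::]; first by split.
  by rewrite /curve_variation big_nil mdistxx.
apply: ereal_sup_ubound; exists [:: b]; first exact: itv_partition1.
by rewrite curve_variation_cons /curve_variation big_nil addr0.
Qed.

Lemma curve_length_ge0 g a b : a <= b -> (0 <= curve_length g a b)%E.
Proof.
by move=> ab; rewrite (le_trans _ (mdist_le_curve_length g ab))// lee_fin mdist_ge0.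
Qed.

Lemma curve_length_superadd g a b c : a <= b -> b <= c ->
  (curve_length g a b + curve_length g b c <= curve_length g a c)%E.
Proof.
move=> ab bc; have V0 := curve_length_ge0 g (le_trans ab bc).
case E : (curve_length g a c) V0 => [r| |] V0; [|exact: leey|by []].
have H p : itv_partition a b p ->
    ((curve_variation g a b p)%:E + curve_length g b c <= r%:E)%E.
  move=> pab; rewrite -leeBrDl//; apply: ge_ereal_sup => _ [q qbc <-].
  rewrite leeBrDl// -EFinD -E; apply: ereal_sup_ubound.
  exists (p ++ q); first exact: itv_partition_cat qbc.
  by congr (_%:E); apply: curve_variation_cat; case: pab => _ /eqP.
(* Finiteness of the second summand allows moving it across the inequality before taking the
   supremum over partitions of [[a, b]]. *)
have bcr : curve_length g b c \is a fin_num.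
  rewrite ge0_fin_numE ?curve_length_ge0//.
  have [p pab] : exists p, itv_partition a b p.
    move: ab; rewrite le_eqVlt => /predU1P[->|ab]; first by exists [::].
    by exists [:: b]; exact: itv_partition1.
  have := H p pab.
  by case: curve_length => // x _; rewrite ltry.
rewrite -leeBrDr//; apply: ge_ereal_sup => _ [p pab <-].
by rewrite leeBrDr// H.
Qed.

Definition rectifiable g a b := (curve_length g a b < +oo)%E.
(* The junk value 0 when the length is infinite. *)
Definition len g a b : R := fine (curve_length g a b).

Lemma lenE g a b : a <= b -> rectifiable g a b ->
  curve_length g a b = (len g a b)%:E.
Proof. by move=> ab gab; rewrite fineK// ge0_fin_numE// curve_length_ge0. Qed.

Lemma len_ge0 g a b : a <= b -> 0 <= len g a b.
Proof. by move=> ab; rewrite fine_ge0// curve_length_ge0. Qed.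

Lemma rectifiable_sub g a b s t : a <= s -> s <= t -> t <= b ->
  rectifiable g a b -> rectifiable g s t.
Proof.
move=> a_s st tb; apply: le_lt_trans.
apply: le_trans (curve_length_superadd g a_s (le_trans st tb)).
apply: le_trans (leeDr _ (curve_length_ge0 g a_s)).
apply: le_trans (curve_length_superadd g st tb).
by rewrite leeDl// curve_length_ge0.
Qed.

Lemma mdist_le_len g a b : a <= b -> rectifiable g a b ->
  mdist (g a) (g b) <= len g a b.
Proof. by move=> ab gab; rewrite -lee_fin -lenE// mdist_le_curve_length. Qed.

Lemma len_majorant g a b (F : R -> R) : a <= b -> majorant g a b F ->
  rectifiable g a b /\ len g a b <= F b - F a.
Proof.
move=> ab /curve_length_majorant Fg.
have gab : rectifiable g a b by apply: le_lt_trans Fg (ltry _).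
by split=> //; rewrite -lee_fin -lenE.
Qed.

Lemma len_nil g a : len g a a = 0.
Proof.
have [|_] := @len_majorant g a a (fun=> 0) (lexx a).
  move=> s t a_s st ta; have -> : s = t.
    by apply/eqP; rewrite eq_le st (le_trans ta).
  by rewrite mdistxx subrr.
by rewrite subrr => la; apply/eqP; rewrite eq_le la len_ge0.
Qed.

(** Superadditivity gives one inequality. For the other, [F] adds up arc length separately on both
    sides of [b]; it is a majorant on [[a, c]], which replaces the insertion of [b] into a
    partition. *)
Lemma lenD g a b c : a <= b -> b <= c -> rectifiable g a c ->
  len g a c = len g a b + len g b c.
Proof.
move=> ab bc gac; have ac := le_trans ab bc.
have gab : rectifiable g a b by exact: rectifiable_sub gac.
have gbc : rectifiable g b c by exact: rectifiable_sub gac.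
have super s t : a <= s -> s <= t -> t <= c -> forall u, s <= u -> u <= t ->
    len g s u + len g u t <= len g s t.
  move=> a_s st tc u su ut; rewrite -lee_fin EFinD -!lenE//.
  - exact: curve_length_superadd.
  - exact: rectifiable_sub gac.
  - by apply: rectifiable_sub gac => //; exact: le_trans su.
  - by apply: rectifiable_sub gac => //; exact: le_trans tc.
apply/eqP; rewrite eq_le super// andbT.
pose F t := if t <= b then len g a t else len g a b + len g b t.
have mono s t : a <= s -> s <= t -> t <= c ->
    mdist (g s) (g t) <= len g s t.
  by move=> *; apply: mdist_le_len => //; exact: rectifiable_sub gac.
have [|_] := @len_majorant g a c F ac.
  move=> s t a_s st tc; rewrite /F; case: (leP t b) => tb.
    rewrite (le_trans st tb) lerBrDl (le_trans _ (super a t _ _ _ s _ _))//.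
      by rewrite lerD2l mono.
    exact: le_trans a_s st.
  case: (leP s b) => sb; last first.
    rewrite [_ + len g b t]addrC opprD addrA addrK lerBrDl.
    by rewrite (le_trans _ (super b t _ _ _ s _ _))// ?lerD2l ?mono// ltW.
  rewrite (le_trans (metric_triangle _ (g b) _))// addrAC lerD//.
    rewrite lerBrDl (le_trans _ (super a b _ _ _ s _ _))//.
    by rewrite lerD2l mono.
  by rewrite mono// ltW.
rewrite /F ab; case: (leP c b) => cb.
  have -> : c = b by apply/eqP; rewrite eq_le cb bc.
  move=> _; rewrite lerDl fine_ge0// curve_length_ge0//.
by rewrite len_nil subr0.
Qed.

Lemma len_homo g a b s t : a <= s -> s <= t -> t <= b -> rectifiable g a b ->
  len g a s <= len g a t.
Proof.
move=> a_s st tb gab; rewrite (lenD a_s st) ?lerDl ?len_ge0//.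
by apply: rectifiable_sub gab => //; exact: le_trans st.
Qed.

End CurveLength.

(** * Epsilon-delta forms of limits, neighbourhoods and continuity on an interval *)

Section EpsDelta.
Context {R : realType} {X : metricType R}.

Lemma seq_cvgP (u : nat -> X) (l : X) : u n @[n --> \oo] --> l <->
  forall e : R, 0 < e -> exists N, forall n, (N <= n)%N -> mdist l (u n) < e.
Proof.
split=> [/metricType_numDomainType.cvgrPdist_lt H e e0|H].
  by have [N _ NP] := H e e0; exists N.
apply/metricType_numDomainType.cvgrPdist_lt => e e0.
by have [N NP] := H e e0; exists N.
Qed.

Lemma metric_nbhsP (x : X) (A : set X) :
  nbhs x A <-> exists2 e : R, 0 < e & forall y, mdist x y < e -> A y.
Proof.
rewrite -metricType_numDomainType.filter_from_mdist_nbhs.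
by split=> -[e e0 eA]; exists e.
Qed.

Lemma within_itvP (g : R -> X) (a b : R) : {within `[a, b], continuous g} <->
  forall t, a <= t <= b -> forall e, 0 < e -> exists2 d, 0 < d &
    forall u, a <= u <= b -> `|t - u| < d -> mdist (g t) (g u) < e.
Proof.
split=> [/subspace_continuousP gc t tab e e0|H].
  have /metricType_numDomainType.cvgrPdist_lt/(_ _ e0) := gc t tab.
  move=> [d /= d0 dP]; exists d => // u uab tu.
  exact: dP.
apply/subspace_continuousP => t tab.
apply/metricType_numDomainType.cvgrPdist_lt => e e0.
by have [d d0 dP] := H t tab e e0; exists d => //= u tu uab; exact: dP.
Qed.

End EpsDelta.

(** * Unit-speed curves and the arc length parametrization *)

Section Reparametrization.
Context {R : realType} {X : metricType R}.
Implicit Types (g h : R -> X) (a b c d s t L M : R).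

(** The arc length of [h] up to [theta t] is a majorant of [g]. Asking only monotonicity of [theta]
    lets it be the arc length function [len g a] itself. *)
Lemma len_comp g h (theta : R -> R) a b c d : a <= b ->
  (forall t, a <= t <= b -> c <= theta t <= d /\ g t = h (theta t)) ->
  (forall s t, a <= s -> s <= t -> t <= b -> theta s <= theta t) ->
  rectifiable h c d -> rectifiable g a b /\ len g a b <= len h c d.
Proof.
move=> ab gh th hcd.
have P t (tab : a <= t <= b) := gh t tab.
have /andP[ca ad] : c <= theta a <= d by apply: (P a _).1; rewrite lexx.
have /andP[cb bd] : c <= theta b <= d by apply: (P b _).1; rewrite lexx ab.
have [s t a_s st tb|gab lab] := @len_majorant _ _ g a b (fun t => len h c (theta t)) ab.
  have [/andP[s1 s2] ->] := P s ltac:(by rewrite a_s (le_trans st)).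
  have [/andP[t1 t2] ->] := P t ltac:(by rewrite tb (le_trans a_s)).
  have hst := th _ _ a_s st tb.
  rewrite lerBrDl (lenD s1 hst) ?lerD2l ?mdist_le_len//.
    exact: rectifiable_sub hcd.
  by apply: rectifiable_sub hcd.
split=> //; apply: le_trans lab _; apply: (@le_trans _ _ (len h c (theta b))).
  by rewrite gerBl len_ge0.
by apply: len_homo hcd.
Qed.

Lemma len_comp_rev g h (theta : R -> R) a b c d : a <= b ->
  (forall t, a <= t <= b -> c <= theta t <= d /\ g t = h (theta t)) ->
  (forall s t, a <= s -> s <= t -> t <= b -> theta t <= theta s) ->
  rectifiable h c d -> rectifiable g a b /\ len g a b <= len h c d.
Proof.
move=> ab gh th hcd.
have P t (tab : a <= t <= b) := gh t tab.
have /andP[ca ad] : c <= theta a <= d by apply: (P a _).1; rewrite lexx.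
have /andP[cb bd] : c <= theta b <= d by apply: (P b _).1; rewrite lexx ab.
have [s t a_s st tb|gab lab] := @len_majorant _ _ g a b (fun t => - len h c (theta t)) ab.
  have [/andP[s1 s2] ->] := P s ltac:(by rewrite a_s (le_trans st)).
  have [/andP[t1 t2] ->] := P t ltac:(by rewrite tb (le_trans a_s)).
  have hst := th _ _ a_s st tb.
  rewrite opprK addrC lerBrDl (lenD t1 hst) ?lerD2l.
    by rewrite metric_sym mdist_le_len//; exact: rectifiable_sub hcd.
  by apply: rectifiable_sub hcd.
split=> //; apply: le_trans lab _; rewrite opprK addrC.
apply: (@le_trans _ _ (len h c (theta a))).
  by rewrite gerBl len_ge0.
by apply: len_homo hcd.
Qed.

Definition unit_speed L h := 0 <= L /\
  forall s t, 0 <= s -> s <= t -> t <= L -> curve_length h s t = (t - s)%:E.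

Lemma unit_speed_rect L h : unit_speed L h -> rectifiable h 0 L.
Proof. by move=> [L0 hL]; rewrite /rectifiable hL// ltry. Qed.

Lemma unit_speed_len L h s t : unit_speed L h -> 0 <= s -> s <= t -> t <= L ->
  len h s t = t - s.
Proof. by move=> [L0 hL] s0 st tL; rewrite /len hL. Qed.

Lemma unit_speed_le L h s t : unit_speed L h -> 0 <= s -> s <= t -> t <= L ->
  mdist (h s) (h t) <= t - s.
Proof.
move=> hL s0 st tL; rewrite -(unit_speed_len hL)// mdist_le_len//.
exact: rectifiable_sub (unit_speed_rect hL).
Qed.

Lemma unit_speed_lip L h s t : unit_speed L h -> 0 <= s <= L -> 0 <= t <= L ->
  mdist (h s) (h t) <= `|s - t|.
Proof.
move=> hL /andP[s0 sL] /andP[t0 tL]; case: (leP s t) => st.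
  by rewrite distrC (le_trans _ (ler_norm _))// (unit_speed_le hL).
by rewrite metric_sym (le_trans _ (ler_norm _))// (unit_speed_le hL)// ltW.
Qed.

(** No length can be lost: the pieces on [[0, s]], [[s, t]] and [[t, L]] are at most as long as
    their parameter intervals, yet add up to at least [L]. *)
Lemma unit_speedP L h : 0 <= L ->
  (forall s t, 0 <= s -> s <= t -> t <= L -> mdist (h s) (h t) <= t - s) ->
  L <= len h 0 L -> unit_speed L h.
Proof.
move=> L0 hL Lh; split=> // s t s0 st tL.
have [h0L _] := @len_majorant _ _ h 0 L id L0 hL.
have sub u v : 0 <= u -> u <= v -> v <= L -> len h u v <= v - u.
  move=> u0 uv vL; apply: (len_majorant uv _).2 => p q up pq qv.
  by apply: hL => //; [exact: le_trans up|exact: le_trans vL].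
have hst : rectifiable h s t by exact: rectifiable_sub h0L.
rewrite (lenE st hst); congr (_%:E).
move: Lh; rewrite (lenD s0 (le_trans st tL))// (lenD st tL); last first.
  by apply: rectifiable_sub h0L => //; exact: le_trans tL.
have := sub 0 s (lexx _) s0 (le_trans st tL).
have := sub s t s0 st tL.
have := sub t L (le_trans s0 st) tL (lexx _).
lra.
Qed.

Lemma unit_speed_restr L M h : unit_speed L h -> 0 <= M -> M <= L ->
  unit_speed M h.
Proof. by move=> [L0 hL] M0 ML; split=> // s t s0 st /le_trans/(_ ML); exact: hL. Qed.

Lemma unit_speed_shift L c h : unit_speed L h -> 0 <= c -> c <= L ->
  unit_speed (L - c) (fun s => h (s + c)).
Proof.
move=> hL c0 cL; apply: unit_speedP; first by rewrite subr_ge0.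
  move=> s t s0 st tL; rewrite (le_trans (unit_speed_le hL _ _ _))//; lra.
rewrite -[leLHS](unit_speed_len hL c0 cL (lexx L)).
apply: (@len_comp _ _ (fun t => t - c) _ _ _ _ cL _ _ _).2.
- move=> t /andP[t1 t2]; split; last by rewrite subrK.
  by apply/andP; lra.
- by move=> s t *; lra.
apply: (len_majorant (F := id) _ _).1; first by rewrite subr_ge0.
by move=> s t s0 st tL; rewrite (le_trans (unit_speed_le hL _ _ _))//; lra.
Qed.

Lemma unit_speed_rev L h : unit_speed L h -> unit_speed L (fun s => h (L - s)).
Proof.
move=> hL; have L0 := hL.1.
have lip s t : 0 <= s -> s <= t -> t <= L -> mdist (h (L - s)) (h (L - t)) <= t - s.
  by move=> s0 st tL; rewrite metric_sym (le_trans (unit_speed_le hL _ _ _)); lra.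
apply: unit_speedP => //.
rewrite -[leLHS]subr0 -(unit_speed_len hL (lexx _) L0 (lexx L)).
apply: (@len_comp_rev _ _ (fun t => L - t) _ _ _ _ L0 _ _ _).2.
- move=> t /andP[t1 t2]; split; last by congr h; ring.
  by apply/andP; lra.
- by move=> s t *; lra.
by apply: (len_majorant (F := id) L0 _).1.
Qed.

Definition curve_cat L g h := fun s => if s <= L then g s else h (s - L).

Lemma unit_speed_cat L M g h : unit_speed L g -> unit_speed M h -> g L = h 0 ->
  unit_speed (L + M) (curve_cat L g h).
Proof.
move=> gL hM gh; have L0 := gL.1; have M0 := hM.1.
have LM0 : 0 <= L + M by rewrite addr_ge0.
have lip s t : 0 <= s -> s <= t -> t <= L + M ->
    mdist (curve_cat L g h s) (curve_cat L g h t) <= t - s.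
  move=> s0 st tLM; rewrite /curve_cat; case: (leP t L) => tL.
    by rewrite (le_trans st tL) (unit_speed_le gL).
  case: (leP s L) => sL; last by rewrite (le_trans (unit_speed_le hM _ _ _))//; lra.
  rewrite (le_trans (metric_triangle _ (g L) _))//.
  have := unit_speed_le gL s0 sL (lexx L); rewrite gh.
  have := @unit_speed_le _ _ 0 (t - L) hM; lra.
have [rc _] := @len_majorant _ _ (curve_cat L g h) 0 (L + M) id LM0 lip.
have LLM : L <= L + M by rewrite lerDl.
apply: unit_speedP => //; rewrite (lenD L0 LLM)//; apply: lerD.
  rewrite -[leLHS]subr0 -(unit_speed_len gL (lexx _) L0 (lexx L)).
  apply: (@len_comp _ _ id _ _ _ _ L0 _ _ _).2 => //.
    by move=> t tL; split=> //; rewrite /curve_cat; case/andP: tL => _ ->.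
  exact: rectifiable_sub rc.
rewrite -[leLHS]subr0 -(unit_speed_len hM (lexx _) M0 (lexx M)).
apply: (@len_comp _ _ (fun t => t + L) _ _ _ _ M0 _ _ _).2 => //.
- move=> t /andP[t0 tM]; split; first by apply/andP; lra.
  rewrite /curve_cat addrK; case: (leP (t + L) L) => // tL.
  have -> : t = 0 by lra.
  by rewrite add0r gh.
- by move=> s t *; lra.
exact: rectifiable_sub rc.
Qed.

Lemma curve_cat_start L g h : 0 <= L -> curve_cat L g h 0 = g 0.
Proof. by rewrite /curve_cat => ->. Qed.

Lemma curve_cat_end L M g h : 0 <= M -> g L = h 0 -> curve_cat L g h (L + M) = h M.
Proof.
move=> M0 gh; rewrite /curve_cat; case: leP => LM; last by rewrite addrC addKr.
have -> : M = 0 by lra.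
by rewrite addr0.
Qed.

Lemma unit_speed_curve L h : unit_speed L h -> is_curve h 0 L.
Proof.
move=> hL; split; first exact: hL.1.
apply/within_itvP => t tL e e0; exists e => // u uL.
exact/le_lt_trans/(unit_speed_lip hL).
Qed.

(** An intermediate value theorem for arc length. At the supremum [T] of the parameters with length
    at most [c], two majorants, valid by continuity of [g] at [T], exclude a jump of the length. *)
Lemma len_surj g a b c : is_curve g a b -> rectifiable g a b ->
  0 <= c <= len g a b -> exists2 t, a <= t <= b & len g a t = c.
Proof.
move=> [ab /within_itvP gc] gab /andP[c0 cl].
have rect s t : a <= s -> s <= t -> t <= b -> rectifiable g s t.
  by move=> *; exact: rectifiable_sub gab.
have lD s t : a <= s -> s <= t -> t <= b -> len g a t = len g a s + len g s t.
  by move=> a_s st tb; apply: lenD => //; apply: rect => //; exact: le_trans st.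
pose S := [set t | a <= t <= b /\ len g a t <= c].
have Sa : S a by split; [rewrite lexx ab|rewrite len_nil].
have Sb : ubound S b by move=> t [/andP[]].
have supS : has_sup S by split; [exists a|exists b].
pose T := sup S.
have aT : a <= T by exact: sup_ubound supS.2 _ Sa.
have Tb : T <= b by apply: ge_sup => //; exists a.
have TP : a <= T <= b by rewrite aT.
exists T => //; apply/eqP; rewrite eq_le; apply/andP; split.
  have lt_T t : a <= t -> t < T -> len g a t <= c.
    move=> a_t /(sup_gt (ex_intro _ _ Sa))[u [/andP[au ub] uc] tu].
    by apply: le_trans uc; rewrite (lD t u)// ?lerDl ?len_ge0// ltW.
  (* Giving [F] the value [c] at [T] keeps it a majorant, hence the length up to [T] is at most
     [c]. *)
  pose F t := if t < T then len g a t else c.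
  have [|_] := @len_majorant _ _ g a T F aT; last first.
    rewrite /F ltxx; case: ifPn => [_|]; first by rewrite len_nil subr0.
    by rewrite subrr => _ /le_trans; apply.
  move=> s t a_s st tT; rewrite /F.
  case: (ltP t T) => tT'.
    rewrite (le_lt_trans st tT') lerBrDl (lD s t)// ?(le_trans tT)//.
    by rewrite lerD2l mdist_le_len//; apply: rect => //; rewrite (le_trans tT).
  have -> : t = T by apply/eqP; rewrite eq_le tT.
  case: (ltP s T) => sT; last first.
    have -> : s = T by apply/eqP; rewrite eq_le sT (le_trans st).
    by rewrite mdistxx subrr.
  apply/ler_addgt0Pr => e e0; have [d d0 dP] := gc T TP e e0.
  pose u := Order.max s (T - d / 2).
  have su : s <= u by rewrite le_max lexx.
  have uT : u < T by rewrite gt_max sT /=; lra.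
  have uT' : T - d / 2 <= u by rewrite le_max lexx orbT.
  have au := le_trans a_s su; have ub := le_trans (ltW uT) Tb.
  rewrite (le_trans (metric_triangle _ (g u) _))// lerD//.
    rewrite lerBrDl (le_trans _ (lt_T u au uT))// (lD s u)// lerD2l.
    by rewrite mdist_le_len//; exact: rect.
  rewrite metric_sym ltW// dP ?au//.
  by rewrite gtr0_norm ?subr_gt0//; lra.
move: Tb; rewrite le_eqVlt => /predU1P[->//|Tb].
have gt_T t : T < t -> t <= b -> c < len g a t.
  move=> Tt tb; rewrite ltNge; apply/negP => tc.
  suff : t <= T by rewrite leNgt Tt.
  by apply: (sup_ubound supS.2); split; rewrite ?tb ?andbT// (le_trans aT)// ltW.
(* The mirror image: with value [c] at [T] this majorant yields [len g T b <= len g a b - c], that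
   is [c <= len g a T]. *)
pose F t := if t <= T then c else len g a t.
have [|_] := @len_majorant _ _ g T b F (ltW Tb); last first.
  by rewrite /F lexx [b <= T]leNgt Tb /= (lD T b (aT) (ltW Tb) (lexx b)); lra.
move=> s t Ts st tb; rewrite /F.
case: (leP s T) => sT; last first.
  rewrite [t <= T]leNgt (lt_le_trans sT st)/= lerBrDl (lD s t)// ?(le_trans aT)//.
  by rewrite lerD2l mdist_le_len//; apply: rect => //; rewrite (le_trans aT).
have -> : s = T by apply/eqP; rewrite eq_le sT.
case: (leP t T) => tT.
  have -> : t = T by apply/eqP; rewrite eq_le tT (le_trans Ts).
  by rewrite mdistxx subrr.
apply/ler_addgt0Pr => e e0; have [d d0 dP] := gc T TP e e0.
pose u := Order.min t (T + d / 2).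
have ut : u <= t by rewrite ge_min lexx.
have uT : T < u by rewrite lt_min tT /=; lra.
have uT' : u <= T + d / 2 by rewrite ge_min lexx orbT.
have au := le_trans aT (ltW uT); have ub := le_trans ut tb.
rewrite (le_trans (metric_triangle _ (g u) _))// addrC lerD//.
  have := gt_T u uT ub; rewrite (lD u t)//.
  have := mdist_le_len ut (rect u t au ut tb); lra.
rewrite ltW// dP ?au//.
by rewrite ltr0_norm ?subr_lt0//; lra.
Qed.

Lemma arc_length_paramP g a b s : is_curve g a b -> rectifiable g a b ->
  0 <= s <= len g a b -> exists t, [/\ a <= t <= b, len g a t = s
    & arc_length_param g a b s = g t].
Proof.
move=> gc gab /(len_surj gc gab)[t tab ts]; rewrite /arc_length_param.
case: xgetP => [u _ /= [uab us]|/(_ t)/=]; first by exists u; split; rewrite // /len us.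
case; split=> //; rewrite -ts -lenE//; first by case/andP: tab.
by case/andP: tab => at_ tb; exact: rectifiable_sub gab.
Qed.

Lemma unit_speed_arc_length g a b : is_curve g a b -> rectifiable g a b ->
  let h := arc_length_param g a b in
  [/\ unit_speed (len g a b) h, h 0 = g a & forall t, a <= t <= b ->
    h (len g a t) = g t].
Proof.
move=> gc gab h; have ab := gc.1.
have P s : 0 <= s <= len g a b ->
    exists t, [/\ a <= t <= b, len g a t = s & h s = g t].
  exact: arc_length_paramP.
have hlen t : a <= t <= b -> h (len g a t) = g t.
  move=> /andP[at_ tb].
  have [|u [/andP[au ub] ut ->]] := P (len g a t).
    by rewrite len_ge0// (len_homo at_ tb (lexx b)).
  have gat : rectifiable g a t by exact: rectifiable_sub gab.
  have gau : rectifiable g a u by exact: rectifiable_sub gab.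
  apply: mdist_positivity; apply/eqP; rewrite eq_le mdist_ge0 andbT.
  case: (leP u t) => tu.
    rewrite (le_trans (mdist_le_len tu _))//; last by move: (lenD au tu gat); lra.
    exact: rectifiable_sub gat.
  rewrite metric_sym (le_trans (mdist_le_len (ltW tu) _))//.
    by apply: rectifiable_sub gau => //; exact: ltW.
  by move: (lenD at_ (ltW tu) gau); lra.
have lip s t : 0 <= s -> s <= t -> t <= len g a b -> mdist (h s) (h t) <= t - s.
  move=> s0 st tl.
  have [|u [/andP[au ub] us ->]] := P s; first by rewrite s0 (le_trans st).
  have [|v [/andP[av vb] vt ->]] := P t; first by rewrite (le_trans s0).
  have gau : rectifiable g a u by exact: rectifiable_sub gab.
  have gav : rectifiable g a v by exact: rectifiable_sub gab.
  case: (leP u v) => uv.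
    rewrite -us -vt (lenD au uv)// addrAC subrr add0r mdist_le_len//.
    exact: rectifiable_sub gab.
  have vu := ltW uv.
  have gvu : rectifiable g v u by exact: rectifiable_sub gab.
  have := lenD av vu gau; have := mdist_le_len vu gvu; rewrite metric_sym; lra.
split=> //; last by rewrite -(len_nil g a) hlen// lexx.
have L0 := len_ge0 g ab.
apply: unit_speedP => //.
(* [g] is [h] composed with the arc length of [g], so [h] is at least as long as [g]. *)
apply: (@len_comp _ _ (len g a) _ _ _ _ ab _ _ _).2.
- move=> t /[dup] tab /andP[at_ tb]; split; last by rewrite hlen.
  by rewrite len_ge0// (len_homo at_ tb (lexx b)).
- by move=> s t a_s st tb; apply: len_homo gab.
by apply: (len_majorant (F := id) L0 _).1.
Qed.

End Reparametrization.

(** * Integrals of continuous functions over compact intervals *)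

Section IntervalIntegral.
Context {R : realType}.
Local Notation mu := (@lebesgue_measure R).
Implicit Types (f : R -> R) (a b c L : R).

Lemma within_itv_realP f a b : {within `[a, b], continuous f} <->
  forall t, a <= t <= b -> forall e, 0 < e -> exists2 d, 0 < d &
    forall u, a <= u <= b -> `|t - u| < d -> `|f t - f u| < e.
Proof.
split=> [/subspace_continuousP fc t tab e e0|H].
  have /cvgrPdist_lt/(_ _ e0)[d /= d0 dP] := fc t tab.
  by exists d => // u uab tu; exact: dP.
apply/subspace_continuousP => t tab; apply/cvgrPdist_lt => e e0.
by have [d d0 dP] := H t tab e e0; exists d => //= u tu uab; exact: dP.
Qed.

Lemma itv_integrable f a b : {within `[a, b], continuous f} ->
  mu.-integrable `[a, b] (EFin \o f).
Proof. by apply: continuous_compact_integrable; exact: segment_compact. Qed.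

Lemma within_itvS f a b c d : a <= c -> d <= b ->
  {within `[a, b], continuous f} -> {within `[c, d], continuous f}.
Proof.
move=> ac db; apply: continuous_subspaceW => t /=; rewrite !in_itv/= => /andP[ct td].
by rewrite (le_trans ac)// (le_trans td).
Qed.

Lemma itv_int_cat f a b c : a <= b -> b <= c -> {within `[a, c], continuous f} ->
  \int[mu]_(s in `[a, c]) f s =
  \int[mu]_(s in `[a, b]) f s + \int[mu]_(s in `[b, c]) f s.
Proof.
move=> ab bc cf; apply/eqP; rewrite addrC -subr_eq; apply/eqP.
rewrite Rintegral_itvB ?bnd_simp//; last exact: itv_integrable.
rewrite Rintegral_itv_obnd_cbnd//.
apply: (@integrableS _ _ _ mu `[b, c]) => //.
  by apply: subset_itvr; rewrite bnd_simp.
by apply: itv_integrable; apply: within_itvS cf.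
Qed.

Lemma itv_int_shift f a b c : a <= b -> {within `[a + c, b + c], continuous f} ->
  \int[mu]_(s in `[a + c, b + c]) f s = \int[mu]_(s in `[a, b]) f (s + c).
Proof.
move=> ab cf; rewrite /Rintegral; congr fine.
have Dshift : derive1 (fun x : R => x + c) = cst 1.
  by apply/funext => z; rewrite derive1E deriveD//= derive_id derive_cst addr0.
have cshift : continuous (fun x : R => x + c).
  by move=> x; apply: cvgD; [exact: cvg_id|exact: cvg_cst].
rewrite (@integration_by_substitution_increasing _ (fun x : R => x + c))//.
- by apply: eq_integral => /= x _; rewrite !fctE Dshift /= mulr1.
- by move=> x y _ _ xy; rewrite ltrD2r.
- by rewrite Dshift => ? _; exact: cvg_cst.
- by rewrite Dshift; exact: is_cvg_cst.
- by rewrite Dshift; exact: is_cvg_cst.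
- split => //.
  + by apply: cvg_at_right_filter; exact: cshift.
  + by apply: cvg_at_left_filter; exact: cshift.
Qed.

Lemma itv_int_rev f L : 0 <= L -> {within `[0, L], continuous f} ->
  \int[mu]_(s in `[0, L]) f (L - s) = \int[mu]_(s in `[0, L]) f s.
Proof.
move=> L0 cf.
have -> : \int[mu]_(s in `[0, L]) f (L - s) = \int[mu]_(s in `[- L, - 0]) f (s + L).
  rewrite [RHS]/Rintegral integration_by_substitution_oppr//.
    by congr fine; apply: eq_integral => s _ /=; rewrite addrC.
  apply/within_itv_realP => t /andP[Lt t0] e e0.
  have tL : 0 <= t + L <= L by apply/andP; lra.
  have [d d0 dP] := (within_itv_realP f 0 L).1 cf _ tL e e0.
  exists d => // u /andP[Lu u0] ud; apply: dP; first by apply/andP; lra.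
  by rewrite opprD addrACA subrr addr0.
by rewrite -itv_int_shift ?addNr ?oppr0 ?add0r// oppr_le0.
Qed.

Lemma itv_int_le f g a b : {within `[a, b], continuous f} ->
  {within `[a, b], continuous g} -> (forall s, a <= s <= b -> f s <= g s) ->
  \int[mu]_(s in `[a, b]) f s <= \int[mu]_(s in `[a, b]) g s.
Proof.
by move=> cf cg fg; apply: le_Rintegral => //; exact: itv_integrable.
Qed.

Lemma itv_int_cst k a b : a <= b -> \int[mu]_(s in `[a, b]) k = k * (b - a).
Proof.
move=> ab; rewrite Rintegral_cst//= lebesgue_measure_itv/= lte_fin.
case: ltP => //= ba; have -> : a = b by apply/eqP; rewrite eq_le ab.
by rewrite subrr.
Qed.

End IntervalIntegral.

(** * The dampening function and its primitive *)

Section DampeningFunction.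
Context {R : realType} {phi : R -> R} {C : R} (Hphi : dampening phi C).
Local Notation mu := (@lebesgue_measure R).

(* phi is unconstrained outside the positive reals, where damp_ext agrees with
   it; damp_ext is continuous and monotone on the whole line. *)
Definition damp_ext (phi : R -> R) (t : R) : R := phi (Num.max t 1).
Local Notation phib := (damp_ext phi).

Lemma max1_gt0 (t : R) : 0 < Num.max t 1.
Proof. by rewrite lt_max ltr01 orbT. Qed.

Lemma damp_extE t : 0 < t -> phib t = phi t.
Proof.
move=> t0; rewrite /damp_ext; case: (leP t 1) => // t1.
by rewrite !(damp_one Hphi).
Qed.

Lemma damp_ext_gt0 t : 0 < phib t.
Proof. exact: (damp_gt0 Hphi (max1_gt0 t)). Qed.

Lemma damp_ext_mono s t : s <= t -> phib t <= phib s.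
Proof.
move=> st; apply: (damp_mono Hphi); first exact: max1_gt0.
by rewrite ge_max !le_max st lexx orbT.
Qed.

Lemma damp_ext1 t : t <= 1 -> phib t = 1.
Proof. by move=> t1; rewrite /damp_ext max_r// (damp_one Hphi). Qed.

Lemma damp_ext_le1 t : phib t <= 1.
Proof.
case: (leP t 1) => t1; first by rewrite damp_ext1.
by rewrite -(damp_ext1 (lexx 1)) damp_ext_mono// ltW.
Qed.

Lemma damp_ext_continuous : continuous phib.
Proof.
move=> t; apply: (@continuous_comp _ _ _ (fun t : R => Num.max t 1) phi); last first.
  exact: (damp_cont Hphi (max1_gt0 t)).
exact: (@continuous_max R R^o id (fun=> 1) t cvg_id (cvg_cst _)).
Qed.

Lemma damp_ext_within a b : {within `[a, b], continuous phib}.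
Proof. by apply: continuous_subspaceT; exact: damp_ext_continuous. Qed.

Lemma damp_ext_within_shift r a b :
  {within `[a, b], continuous (fun s => phib (s + r))}.
Proof.
apply: continuous_subspaceT => s.
apply: (@continuous_comp _ _ _ (fun s : R => s + r) phib); last exact: damp_ext_continuous.
by apply: cvgD; [exact: cvg_id|exact: cvg_cst].
Qed.

Lemma damp_ext_scale t k : 0 <= t -> phib (t / 2 ^+ k) <= C ^+ k * phib t.
Proof.
elim: k t => [|k ih] t t0; first by rewrite divr1 mul1r.
have C1 := damp_C Hphi.
have E : t = 2 * (t / 2) by field.
have t20 : 0 <= t / 2 by lra.
rewrite exprS invfM mulrA (le_trans (ih (t / 2) t20))//.
rewrite exprSr -mulrA ler_wpM2l ?exprn_ge0//; first by lra.
(* Doubling holds at positive arguments; at [t = 0] the claim is [phib 0 <= C * phib 0]. *)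
case: (leP (t / 2) 0) => t2; last first.
  have t1 : 0 < t by lra.
  by have := damp_doubling Hphi t2; rewrite -E !damp_extE.
have -> : t = 0 by lra.
by rewrite mul0r ler_peMl// ltW// damp_ext_gt0.
Qed.

(** The exponent is a number of halvings that suffices to divide by [A], as
    [A <= 2 ^+ (Num.truncn A).+1]. *)
Definition damp_const (C A : R) : R := C ^+ (Num.truncn A).+1.

Lemma damp_const_ge1 A : 1 <= damp_const C A.
Proof. by rewrite exprn_ege1// (damp_C Hphi). Qed.

Lemma damp_ext_div A t : 0 <= t -> 1 <= A -> phib (t / A) <= damp_const C A * phib t.
Proof.
move=> t0 A1; apply: le_trans (damp_ext_scale _ t0); apply: damp_ext_mono.
rewrite ler_wpM2l// lef_pV2 ?posrE ?exprn_gt0//; last lra.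
rewrite (le_trans (ltW (truncnS_gt A)))// -natrX ler_nat.
exact/ltnW/ltn_expl.
Qed.

Definition Damp (u : R) : R := \int[mu]_(s in `[0, u]) phib s.

Lemma Damp0 : Damp 0 = 0.
Proof. by rewrite /Damp set_itv1 Rintegral_set1. Qed.

Lemma DampB s t : 0 <= s -> s <= t ->
  Damp t - Damp s = \int[mu]_(u in `[s, t]) phib u.
Proof.
move=> s0 st; rewrite /Damp (itv_int_cat s0 st); last exact: damp_ext_within.
by rewrite addrC addKr.
Qed.

Lemma Damp_shift r L : 0 <= r -> 0 <= L ->
  \int[mu]_(u in `[0, L]) phib (u + r) = Damp (r + L) - Damp r.
Proof.
move=> r0 L0; rewrite -itv_int_shift//; last exact: damp_ext_within.
by rewrite DampB// ?lerDl// add0r addrC.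
Qed.

Lemma Damp_ge s t : 0 <= s -> s <= t -> phib t * (t - s) <= Damp t - Damp s.
Proof.
move=> s0 st; rewrite DampB// -itv_int_cst//; apply: itv_int_le.
- by apply: continuous_subspaceT => ?; exact: cvg_cst.
- exact: damp_ext_within.
by move=> u /andP[_ ut]; exact: damp_ext_mono.
Qed.

Lemma Damp_le s t : 0 <= s -> s <= t -> Damp t - Damp s <= phib s * (t - s).
Proof.
move=> s0 st; rewrite DampB// -itv_int_cst//; apply: itv_int_le.
- exact: damp_ext_within.
- by apply: continuous_subspaceT => ?; exact: cvg_cst.
by move=> u /andP[su _]; exact: damp_ext_mono.
Qed.

Lemma Damp_lip s t : 0 <= s -> s <= t -> Damp t - Damp s <= t - s.
Proof.
move=> s0 st; apply: le_trans (Damp_le s0 st) _.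
by rewrite ler_piMl ?subr_ge0// damp_ext_le1.
Qed.

Lemma Damp_homo s t : 0 <= s -> s <= t -> Damp s <= Damp t.
Proof.
move=> s0 st; rewrite -subr_ge0; apply: le_trans (Damp_ge s0 st).
by rewrite mulr_ge0 ?subr_ge0// ltW// damp_ext_gt0.
Qed.

Lemma Damp_ge0 s : 0 <= s -> 0 <= Damp s.
Proof. by move=> s0; rewrite -Damp0 Damp_homo. Qed.

(** On the range where [phi] is 1 the primitive measures true length; this is the source of the
    isometry near the boundary. *)
Lemma Damp_eq1 r d : 0 <= r -> 0 <= d -> r + d <= 1 -> Damp (r + d) - Damp r = d.
Proof.
move=> r0 d0 rd; have rrd : r <= r + d by rewrite lerDl.
apply/eqP; rewrite eq_le; apply/andP; split.
  by have := Damp_lip r0 rrd; lra.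
by have := Damp_ge r0 rrd; rewrite damp_ext1//; lra.
Qed.

(** The mean slope of [Phi] is at least [phib (r + d)] on [[r, r + d]] and at most that beyond. The
    lemma moves a factor from the argument of [Phi] to the front. *)
Lemma Damp_concave r d A : 0 <= r -> 0 <= d -> 1 <= A ->
  Damp (r + A * d) - Damp r <= A * (Damp (r + d) - Damp r).
Proof.
move=> r0 d0 A1.
have rd : r <= r + d by rewrite lerDl.
have dAd : d <= A * d by rewrite ler_peMl.
have H1 := Damp_ge r0 rd.
have H2 : Damp (r + A * d) - Damp (r + d) <= phib (r + d) * ((r + A * d) - (r + d)).
  by apply: Damp_le; lra.
have : (A - 1) * (phib (r + d) * d) <= (A - 1) * (Damp (r + d) - Damp r).
  by rewrite ler_wpM2l ?subr_ge0//; move: H1; rewrite addrAC subrr add0r.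
lra.
Qed.

Lemma Damp_decr r s d : 0 <= r -> 0 <= s -> 0 <= d ->
  Damp (r + s + d) - Damp (r + s) <= Damp (s + d) - Damp s.
Proof.
move=> r0 s0 d0; rewrite -!Damp_shift//; last by rewrite addr_ge0.
apply: itv_int_le => [||u _]; [exact: damp_ext_within_shift..|].
by apply: damp_ext_mono; lra.
Qed.

(** This is where the integrability of [phi] enters. *)
Lemma Damp_bounded : exists M, forall u, 0 <= u -> Damp u <= M.
Proof.
have mphi : measurable_fun (`]0%R, +oo[%classic : set (measurableTypeR R)) phi.
  apply: (eq_measurable_fun phib).
    by move=> t; rewrite inE/= in_itv/= andbT => /damp_extE.
  by apply: measurable_funTS; apply: measurable_realfun.continuous_measurable_fun; exact: damp_ext_continuous.
exists (fine (\int[mu]_(t in `]0%R, +oo[) (phi t)%:E)) => u u0.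
(* The half-open interval leaves out 0, where [phib] and [phi] need not agree. *)
rewrite /Damp -Rintegral_itv_obnd_cbnd; last first.
  apply: (@integrableS _ _ _ mu `[0, u]) => //.
    by apply: subset_itvr; rewrite bnd_simp.
  by apply: itv_integrable; exact: damp_ext_within.
have phi0 t : `]0, +oo[%classic t -> (0 <= (phi t)%:E)%E.
  by rewrite /= in_itv/= andbT lee_fin => /(damp_gt0 Hphi)/ltW.
have sub : `]0, u] `<=` `]0, +oo[%classic.
  by move=> t /=; rewrite !in_itv/= andbT => /andP[].
have le : (\int[mu]_(t in `]0%R, u]) (phib t)%:E <= \int[mu]_(t in `]0%R, +oo[) (phi t)%:E)%E.
  have -> : (\int[mu]_(t in `]0%R, u]) (phib t)%:E = \int[mu]_(t in `]0%R, u]) (phi t)%:E)%E.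
    by apply: eq_integral => t; rewrite inE/= in_itv/= => /andP[/damp_extE -> _].
  by apply: ge0_subset_integral => //; exact/measurable_realfun.measurable_EFinP.
have fin : (\int[mu]_(t in `]0%R, +oo[) (phi t)%:E)%E \is a fin_num.
  by rewrite ge0_fin_numE ?(damp_int Hphi)//; exact: integral_ge0.
apply: fine_le => //; rewrite ge0_fin_numE; last first.
  by apply: integral_ge0 => t _; rewrite lee_fin ltW// damp_ext_gt0.
exact: le_lt_trans le (damp_int Hphi).
Qed.

(** By monotonicity of [Damp], its limit at infinity, the total integral of [phi]. *)
Definition Dampoo : R := sup [set Damp u | u in [set u | 0 <= u]].

Let Dampoo_sup : has_sup [set Damp u | u in [set u | 0 <= u]].
Proof.
split; first by exists (Damp 0), 0 => /=.
by have [M MP] := Damp_bounded; exists M => _ [u u0 <-]; exact: MP.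
Qed.

Lemma Damp_lt_oo u : 0 <= u -> Damp u < Dampoo.
Proof.
move=> u0; have u1 : 0 <= u + 1 by lra.
have uu1 : u <= u + 1 by lra.
apply: (@lt_le_trans _ _ (Damp (u + 1))).
  rewrite -subr_gt0; apply: lt_le_trans (Damp_ge u0 uu1).
  by rewrite mulr_gt0 ?damp_ext_gt0//; lra.
by apply: (sup_ubound Dampoo_sup.2); exists (u + 1).
Qed.

Lemma Damp_cvg_oo e : 0 < e -> exists2 u, 0 <= u &
  forall v, u <= v -> Dampoo - Damp v < e.
Proof.
move=> e0; have [_ [u u0 <-] ue] := sup_adherent e0 Dampoo_sup.
exists u => // v uv; have := Damp_homo u0 uv; rewrite -/Dampoo in ue; lra.
Qed.

End DampeningFunction.

(** * The boundary and the distance to it *)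

Section BoundaryDistance.
Context {R : realType} {X : metricType R}.
Implicit Types (x y : X) (z : completion X).

Lemma boundaryPn z : ~ boundary z -> exists x, z = embed x.
Proof. by move=> /contrapT[x _ <-]; exists x. Qed.

Lemma embed_seq_cvg (u : nat -> X) (l : X) :
  embed (u n) @[n --> \oo] --> embed l <-> u n @[n --> \oo] --> l.
Proof.
split=> /seq_cvgP H; apply/seq_cvgP => e /H[N NP]; exists N => n /NP;
  by rewrite mdist_embed.
Qed.

Lemma seq_cvg_unique {Y : metricType R} (u : nat -> Y) (a b : Y) :
  u n @[n --> \oo] --> a -> u n @[n --> \oo] --> b -> a = b.
Proof.
move=> /seq_cvgP ua /seq_cvgP ub; apply: mdist_positivity; apply/eqP.
rewrite eq_le mdist_ge0 andbT; apply/ler_addgt0Pr => e e0; rewrite add0r.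
have e2 : 0 < e / 2 by rewrite divr_gt0.
have [N NP] := ua _ e2; have [M MP] := ub _ e2.
rewrite (le_trans (metric_triangle _ (u (maxn N M)) _))//.
have := NP (maxn N M) (leq_maxl _ _); have := MP (maxn N M) (leq_maxr _ _).
by rewrite (metric_sym b); lra.
Qed.

Lemma completion_seq z : exists2 u : nat -> X, cauchy (u @ \oo) &
  embed (u n) @[n --> \oo] --> z.
Proof.
exists (sval (repr z)); first exact/asboolP/(svalP (repr z)).
by have := @embed_cvg _ _ (repr z); rewrite reprK.
Qed.

Lemma cauchy_embed_cvg (u : nat -> X) : cauchy (u @ \oo) ->
  exists z : completion X, embed (u n) @[n --> \oo] --> z.
Proof.
move=> uC; have uC' : `[< cauchy (u @ \oo) >] by exact/asboolP.
by have := @embed_cvg _ _ (exist _ u uC'); set z := (X in _ --> X) => uz; exists z.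
Qed.

Lemma cvg_cauchy_seq {Y : metricType R} (u : nat -> Y) (a : Y) :
  u n @[n --> \oo] --> a -> forall e : R, 0 < e ->
  exists N, forall m n, (N <= m)%N -> (N <= n)%N -> mdist (u m) (u n) < e.
Proof.
move=> /seq_cvgP ua e e0; have e2 : 0 < e / 2 by rewrite divr_gt0.
have [N NP] := ua _ e2; exists N => m n Nm Nn.
rewrite (le_lt_trans (metric_triangle _ a _))//.
by have := NP _ Nm; have := NP _ Nn; rewrite (metric_sym (u m)); lra.
Qed.

Lemma boundary_nonempty : ~ seq_complete X -> exists z : completion X, boundary z.
Proof.
move=> nX; apply: contrapT => nb; apply: nX => u /cauchy_embed_cvg[z uz].
have [|l zl] := @boundaryPn z; first by move=> bz; apply: nb; exists z.
by exists l; apply/embed_seq_cvg; rewrite -zl.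
Qed.

Hypothesis ncX : ~ seq_complete X.

Let bdist_has_inf x : has_inf [set mdist (embed x) z | z in @boundary R X].
Proof.
split; last by exists 0 => _ [z _ <-]; exact: mdist_ge0.
by have [z zb] := boundary_nonempty ncX; exists (mdist (embed x) z), z.
Qed.

Lemma bdist_le x z : boundary z -> bdist x <= mdist (embed x) z.
Proof. by move=> zb; apply: ge_inf; [exact: (bdist_has_inf x).2|exists z]. Qed.

Lemma bdist_near x e : 0 < e ->
  exists2 z, boundary z & mdist (embed x) z < bdist x + e.
Proof.
by move=> e0; have [_ [z zb <-] ze] := inf_adherent e0 (bdist_has_inf x); exists z.
Qed.

Lemma bdist_ge x m : (forall z, boundary z -> m <= mdist (embed x) z) -> m <= bdist x.
Proof.
move=> mP; apply: lb_le_inf; first exact: (bdist_has_inf x).1.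
by move=> _ [z zb <-]; exact: mP.
Qed.

Lemma bdist_ge0 x : 0 <= bdist x.
Proof. by apply: bdist_ge => z _; exact: mdist_ge0. Qed.

Lemma bdist_lip x y : bdist x <= bdist y + mdist x y.
Proof.
rewrite -lerBlDr; apply: bdist_ge => z zb; rewrite lerBlDr.
rewrite (le_trans (bdist_le x zb))// addrC -mdist_embed.
exact: metric_triangle.
Qed.

(** Otherwise a boundary point would be so close to [x] that a Cauchy sequence approaching it ends
    up in a compact neighbourhood of [x]; its cluster point there is its limit, so the boundary
    point would lie in [X]. *)
Lemma bdist_gt0 x : locally_compact [set: X] -> 0 < bdist x.
Proof.
move=> lcX; have [U + [cU _]] := lcX x I.
move=> /metric_nbhsP[e e0 eU]; rewrite lt_neqAle bdist_ge0 andbT.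
apply/eqP => b0; have e2 : 0 < e / 2 by rewrite divr_gt0.
have [z zb] := bdist_near x e2; rewrite -b0 add0r => xz.
have [u uC uz] := completion_seq z.
have [N NP] := (seq_cvgP _ _).1 uz _ e2.
have [l ul] : exists l : X, u n @[n --> \oo] --> l.
  have uU : (u @ \oo) U.
    exists N => // n /= /NP zu; apply: eU => //.
    by rewrite -mdist_embed (le_lt_trans (metric_triangle _ z _))//; lra.
  have [l [_ lu]] := cU (u @ \oo) _ uU.
  exists l; apply/seq_cvgP => d d0; have d2 : 0 < d / 2 by rewrite divr_gt0.
  have [M MP] := (cauchy_seqP u).1 uC _ d2; exists M => n Mn.
  have uM : (u @ \oo) (u @` [set k | (M <= k)%N]) by exists M => // k Mk; exists k.
  have lb : nbhs l [set y | mdist l y < d / 2] by apply/metric_nbhsP; exists (d / 2).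
  have [_ [[k Mk <-] lk]] := lu _ _ uM lb.
  rewrite (le_lt_trans (metric_triangle _ (u k) _))//.
  by move: lk (MP k n Mk Mn) => /=; lra.
apply: zb; exists l => //.
by apply: (@seq_cvg_unique _ (fun n => embed (u n)) _ _ _ uz); exact/embed_seq_cvg.
Qed.

End BoundaryDistance.

(** * Two-sided estimates of [dphi] *)

Section ConformalDistance.
Context {R : realType} {X : metricType R} {U : R} {phi : R -> R} {C : R}.
Hypotheses (HX : uniform_domain U X) (Hphi : dampening phi C).
Local Notation mu := (@lebesgue_measure R).
Local Notation phib := (damp_ext phi).
Local Notation Phi := (Damp (phi := phi)).
Implicit Types (g h : R -> X) (a b c d s t L M : R) (x y z : X).

Let ncX : ~ seq_complete X. Proof. by case: HX => _ []. Qed.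
Let U1 : 1 <= U. Proof. by case: HX => _ []. Qed.
Let bdist0 x : 0 < bdist x. Proof. by apply: bdist_gt0 => //; case: HX. Qed.

Lemma uniform_unit_speed x y : exists L h,
  [/\ unit_speed L h, h 0 = x, h L = y, L <= U * mdist x y &
      forall s, 0 <= s <= L -> Num.min s (L - s) <= U * bdist (h s)].
Proof.
have [->|/eqP xy] := eqVneq x y.
  exists 0, (fun=> y); split=> //; last 2 first.
  - by rewrite mdistxx mulr0.
  - move=> s /andP[s0 s1]; rewrite ge_min; apply/orP; left.
    by rewrite (le_trans s1)// mulr_ge0 ?bdist_ge0//; move: U1; lra.
  apply: unit_speedP => //; last exact: len_ge0.
  by move=> s t s0 st t0; rewrite mdistxx subr_ge0.
have [_ [_ _ UX]] := HX; have [g [a [b [[gc ga gb] [glen gU]]]]] := UX x y xy.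
have grect : rectifiable g a b by apply: le_lt_trans glen (ltry _).
have [hL h0 hg] := unit_speed_arc_length gc grect.
have ab := gc.1.
exists (len g a b), (arc_length_param g a b); split=> //.
- by rewrite h0.
- by rewrite hg ?lexx ?ab.
- by rewrite -lee_fin -lenE// -ga -gb.
move=> s sL; have [t [tab <- ->]] := arc_length_paramP gc grect sL.
have /andP[at_ tb] := tab.
have := gU t at_ tb; rewrite !lenE//; last 2 first.
- exact: rectifiable_sub grect.
- exact: rectifiable_sub grect.
by rewrite (lenD at_ tb grect) addrAC subrr add0r -EFin_min lee_fin.
Qed.

Definition cost L h := \int[mu]_(s in `[0, L]) phib (bdist (h s)).

Lemma cost_within L h : unit_speed L h ->
  {within `[0, L], continuous (fun s => phib (bdist (h s)))}.
Proof.
move=> hL; apply/within_itv_realP => t tL e e0.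
have /cvgrPdist_lt/(_ _ e0)[d /= d0 dP] := @damp_ext_continuous _ _ _ Hphi (bdist (h t)).
exists d => // u uL tu; apply: dP => /=; apply: le_lt_trans tu.
apply: le_trans (unit_speed_lip hL tL uL).
have := bdist_lip ncX (h t) (h u); have := bdist_lip ncX (h u) (h t).
by rewrite (metric_sym (h u)) ler_norml => H1 H2; apply/andP; split; lra.
Qed.

Lemma cost_ge0 L h : 0 <= cost L h.
Proof. by apply: Rintegral_ge0 => s _; rewrite ltW// (damp_ext_gt0 Hphi). Qed.

Lemma cost_cat L M g h : unit_speed L g -> unit_speed M h -> g L = h 0 ->
  cost (L + M) (curve_cat L g h) = cost L g + cost M h.
Proof.
move=> gL hM gh; have gh' := unit_speed_cat gL hM gh.
have L0 := gL.1; have M0 := hM.1.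
have LLM : L <= L + M by rewrite lerDl.
have E1 : \int[mu]_(s in `[0, L]) phib (bdist (curve_cat L g h s)) = cost L g.
  by apply: eq_Rintegral => s; rewrite inE/= in_itv/= /curve_cat => /andP[_ ->].
have E2 : \int[mu]_(s in `[L, L + M]) phib (bdist (curve_cat L g h s)) = cost M h.
  have : \int[mu]_(s in `[0 + L, M + L]) phib (bdist (curve_cat L g h s)) = cost M h.
    rewrite itv_int_shift; [|exact: M0|]; last first.
      by rewrite add0r addrC; apply: within_itvS (cost_within gh').
    apply: eq_Rintegral => s; rewrite inE/= in_itv/= /curve_cat => /andP[s0 _].
    rewrite addrK; case: leP => [sL|_]; last reflexivity.
    have -> : s = 0 by lra.
    by rewrite add0r gh.
  by rewrite add0r addrC.
by rewrite {1}/cost (itv_int_cat L0 LLM (cost_within gh')) E1 E2.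
Qed.

Lemma cost_rev L h : unit_speed L h -> cost L (fun s => h (L - s)) = cost L h.
Proof. by move=> hL; apply: (itv_int_rev hL.1 (cost_within hL)). Qed.

Lemma line_integral_cost g a b : is_curve g a b -> rectifiable g a b ->
  line_integral (phi \o @bdist R X) g a b = cost (len g a b) (arc_length_param g a b).
Proof.
move=> gc gab; apply: eq_Rintegral => s _ /=.
by rewrite (damp_extE Hphi).
Qed.

Let dphi_set x y := [set r | exists (g : R -> X) (a b : R),
    [/\ joins g a b x y, (curve_length g a b < +oo)%E
      & r = line_integral (phi \o @bdist R X) g a b]].

(** Passing to the arc length parametrization does not change the line integral, so the infimum runs
    over unit-speed curves. *)
Let dphi_setP x y r : dphi_set x y r <-> exists L h,
  [/\ unit_speed L h, h 0 = x, h L = y & r = cost L h].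
Proof.
split=> [[g [a [b [[gc ga gb] gab ->]]]]|[L [h [hL h0 hy ->]]]].
  have [hL h0 hg] := unit_speed_arc_length gc gab.
  exists (len g a b), (arc_length_param g a b); split=> //.
  - by rewrite h0.
  - by rewrite hg ?lexx ?gc.1.
  exact: line_integral_cost.
have hc := unit_speed_curve hL; have hr := unit_speed_rect hL.
exists h, 0, L; split=> //.
have lL : len h 0 L = L by rewrite (unit_speed_len hL) ?subr0// hL.1.
rewrite (line_integral_cost hc hr) lL; apply: eq_Rintegral => s.
rewrite inE/= in_itv/= => sL.
have [_ _ hg] := unit_speed_arc_length hc hr.
have /andP[s0 sL'] := sL; have ls := unit_speed_len hL (lexx 0) s0 sL'.
by have := hg s sL; rewrite ls subr0 => ->.
Qed.

Let dphi_set_inf x y : has_inf (dphi_set x y).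
Proof.
split.
  have [L [h [hL h0 hy _ _]]] := uniform_unit_speed x y.
  by exists (cost L h); apply/dphi_setP; exists L, h.
by exists 0 => r /dphi_setP[L [h [_ _ _ ->]]]; exact: cost_ge0.
Qed.

Lemma dphi_le_cost L h : unit_speed L h -> dphi phi (h 0) (h L) <= cost L h.
Proof.
move=> hL; apply: ge_inf; first exact: (dphi_set_inf _ _).2.
by apply/dphi_setP; exists L, h.
Qed.

Lemma dphi_ge x y m : (forall L h, unit_speed L h -> h 0 = x -> h L = y ->
  m <= cost L h) -> m <= dphi phi x y.
Proof.
move=> mP; apply: lb_le_inf; first exact: (dphi_set_inf _ _).1.
by move=> r /dphi_setP[L [h [hL h0 hy ->]]]; exact: mP.
Qed.

Lemma dphi_near x y e : 0 < e -> exists L h,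
  [/\ unit_speed L h, h 0 = x, h L = y & cost L h < dphi phi x y + e].
Proof.
move=> e0; have [r /dphi_setP[L [h [hL h0 hy ->]]] re] :=
  inf_adherent e0 (dphi_set_inf x y).
by exists L, h.
Qed.

Lemma dphi_ge0 x y : 0 <= dphi phi x y.
Proof. by apply: dphi_ge => *; exact: cost_ge0. Qed.

Lemma dphi_sym x y : dphi phi x y = dphi phi y x.
Proof.
have H (u v : X) : dphi phi u v <= dphi phi v u.
  apply: dphi_ge => L h hL h0 hy; rewrite -(cost_rev hL).
  have := dphi_le_cost (unit_speed_rev hL).
  by rewrite subr0 subrr h0 hy.
by apply/eqP; rewrite eq_le !H.
Qed.

Lemma dphi_triangle y x z : dphi phi x z <= dphi phi x y + dphi phi y z.
Proof.
apply/ler_addgt0Pr => e e0; have e2 : 0 < e / 2 by rewrite divr_gt0.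
have [L [g [gL g0 gy gc]]] := dphi_near x y e2.
have [M [h [hM h0 hz hc]]] := dphi_near y z e2.
have gh : g L = h 0 by rewrite gy h0.
have := dphi_le_cost (unit_speed_cat gL hM gh).
rewrite (cost_cat gL hM gh) (curve_cat_start _ _ gL.1) (curve_cat_end hM.1 gh) g0 hz.
move=> /le_trans; apply; rewrite (splitr e) addrACA; apply: lerD; exact: ltW.
Qed.

Lemma cost_le L h : unit_speed L h -> cost L h <= L.
Proof.
move=> hL; have L0 := hL.1.
have -> : cost L h <= L = (cost L h <= 1 * (L - 0)) by rewrite subr0 mul1r.
rewrite -(itv_int_cst 1 L0); apply: itv_int_le.
- exact: cost_within.
- by apply: continuous_subspaceT => ?; exact: cvg_cst.
by move=> s _; exact: (damp_ext_le1 Hphi).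
Qed.

Lemma dphi_le x y : dphi phi x y <= U * mdist x y.
Proof.
have [L [h [hL h0 hx lL _]]] := uniform_unit_speed x y.
have := dphi_le_cost hL; rewrite h0 hx; have := cost_le hL; lra.
Qed.

(* At arc length s along a curve from x, the distance to the boundary is at
   most bdist x + s. *)
Lemma dphi_lower x y : Phi (bdist x + mdist x y) - Phi (bdist x) <= dphi phi x y.
Proof.
apply: dphi_ge => L h hL h0 hy; have L0 := hL.1; have b0 := bdist_ge0 ncX x.
have xyL : mdist x y <= L.
  by have := unit_speed_le hL (lexx 0) L0 (lexx L); rewrite h0 hy subr0.
apply: (@le_trans _ _ (Phi (bdist x + L) - Phi (bdist x))).
  rewrite lerD2r (Damp_homo Hphi)//; first by rewrite addr_ge0 ?mdist_ge0.
  by rewrite lerD2l.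
rewrite -(Damp_shift Hphi b0 L0); apply: itv_int_le.
- exact: (damp_ext_within_shift Hphi).
- exact: cost_within.
move=> s /andP[s0 sL]; apply: (damp_ext_mono Hphi).
have := bdist_lip ncX (h s) x; have := unit_speed_le hL (lexx 0) s0 sL.
by rewrite h0 metric_sym; lra.
Qed.

(** The way back from [dphi] to [d]: the lower bound is uniform in [y] and in all [x] with
    [bdist x <= b], so [dphi]-closeness to such an [x] forces [d]-closeness. *)
Lemma dphi_sep x y b e : 0 <= e -> bdist x <= b -> e <= mdist x y ->
  phib (b + e) * e <= dphi phi x y.
Proof.
move=> e0 xb exy; have b0 := bdist_ge0 ncX x.
have b1 : bdist x <= bdist x + e by rewrite lerDl.
apply: le_trans (dphi_lower x y).
apply: (@le_trans _ _ (Phi (bdist x + e) - Phi (bdist x))).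
  have := Damp_ge Hphi b0 b1; rewrite addrAC subrr add0r.
  apply: le_trans; apply: ler_wpM2r => //.
  by apply: (damp_ext_mono Hphi); rewrite lerD2r.
rewrite lerD2r; apply: (Damp_homo Hphi); first exact: le_trans b1.
by rewrite lerD2l.
Qed.

(** The one-sided half of uniformity: a John curve, or carrot, that widens away from [h 0]. It also
    makes sense for rays, which have no second end point. *)
Definition john J L h :=
  unit_speed L h /\ forall s, 0 <= s <= L -> s <= J * bdist (h s).

Definition john_const (C J : R) := damp_const C (1 + 2 * J).

Lemma unit_speed_dphi L h s t : unit_speed L h -> 0 <= s -> s <= t -> t <= L ->
  dphi phi (h s) (h t) <= cost (t - s) (fun u => h (u + s)).
Proof.
move=> hL s0 st tL.
have hs : unit_speed (t - s) (fun u => h (u + s)).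
  apply: unit_speed_restr (unit_speed_shift hL s0 (le_trans st tL)) _ _; lra.
by have := dphi_le_cost hs; rewrite add0r subrK.
Qed.

Lemma john_dphi J L h s t : 1 <= J -> john J L h ->
  0 <= s -> s <= t -> t <= L ->
  dphi phi (h s) (h t) <=
    john_const C J * (Phi (bdist (h 0) + t) - Phi (bdist (h 0) + s)).
Proof.
move=> J1 [hL hJ] s0 st tL; have b0 := bdist_ge0 ncX (h 0).
have bs0 : 0 <= bdist (h 0) + s by rewrite addr_ge0.
have ts0 : 0 <= t - s by rewrite subr_ge0.
apply: le_trans (unit_speed_dphi hL s0 st tL) _.
have -> : bdist (h 0) + t = (bdist (h 0) + s) + (t - s) by ring.
rewrite -(Damp_shift Hphi bs0 ts0) -RintegralZl//; last first.
  exact/itv_integrable/(damp_ext_within_shift Hphi).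
apply: itv_int_le.
- apply: cost_within; apply: unit_speed_restr (unit_speed_shift hL s0 _) _ _ => //; lra.
- apply: continuous_subspaceT => v; apply: cvgM; first exact: cvg_cst.
  apply: (@continuous_comp _ _ _ (fun w : R => w + (bdist (h 0) + s)) phib).
    by apply: cvgD; [exact: cvg_id|exact: cvg_cst].
  exact: (damp_ext_continuous Hphi).
move=> u /andP[u0 uts].
have us : 0 <= u + s <= L by apply/andP; lra.
have hJu := hJ _ us; have hlip := bdist_lip ncX (h 0) (h (u + s)).
have hle : mdist (h 0) (h (u + s)) <= u + s.
  have := @unit_speed_le _ _ _ _ 0 (u + s) hL (lexx _); rewrite subr0; apply; lra.
apply: le_trans (damp_ext_div Hphi _ _); [|lra..].
apply: (damp_ext_mono Hphi); rewrite ler_pdivrMr; lra.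
Qed.

End ConformalDistance.

(** * Images of uniform curves, and the construction of rays *)

Section UniformCurves.
Context {R : realType} {X : metricType R} {U : R} {phi : R -> R} {C : R}.
Hypotheses (HX : uniform_domain U X) (Hphi : dampening phi C).
Local Notation phib := (damp_ext phi).
Local Notation Phi := (Damp (phi := phi)).
Local Notation Phioo := (Dampoo (phi := phi)).
Implicit Types (g h : R -> X) (a b c d s t L M : R) (x y z : X).

Let ncX : ~ seq_complete X. Proof. by case: HX => _ []. Qed.
Let U1 : 1 <= U. Proof. by case: HX => _ []. Qed.

Lemma john_const_ge1 J : 1 <= john_const C J.
Proof. exact: (damp_const_ge1 Hphi). Qed.

Let john_const_ge0 J : 0 <= john_const C J.
Proof. exact: le_trans (john_const_ge1 J). Qed.

Lemma uniform_john x y : exists L h, [/\ unit_speed L h, h 0 = x, h L = y,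
   L <= U * mdist x y &
   john U (L / 2) h /\ john U (L / 2) (fun s => h (L - s))].
Proof.
have [L [h [hL h0 hy lL hU]]] := uniform_unit_speed HX x y.
exists L, h; split=> //; have L0 := hL.1; split; split.
- by apply: unit_speed_restr hL _ _; lra.
- move=> s /andP[s0 sL]; have := hU s; rewrite min_l; last lra.
  by apply; apply/andP; lra.
- by apply: unit_speed_restr (unit_speed_rev hL) _ _; lra.
move=> s /andP[s0 sL]; have := hU (L - s); rewrite min_r; last lra.
by rewrite subKr; apply; apply/andP; lra.
Qed.

(** The bound ignores [mdist x y]: points far from the boundary are [dphi]-close however far apart
    they are. This makes infinity a single point. *)
Lemma dphi_upper x y : dphi phi x y <=
  john_const C U * (Phioo - Phi (bdist x)) + john_const C U * (Phioo - Phi (bdist y)).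
Proof.
have [L [h [hL h0 hy _ [j1 j2]]]] := uniform_john x y; have L0 := hL.1.
have L20 : 0 <= L / 2 by lra.
have := john_dphi HX Hphi U1 j1 (lexx 0) L20 (lexx _).
have := john_dphi HX Hphi U1 j2 (lexx 0) L20 (lexx _).
rewrite /= subr0 h0 hy !addr0 (_ : L - L / 2 = L / 2); last by field.
rewrite (dphi_sym HX Hphi y) => H2 H1.
have D z : Phi (bdist z + L / 2) <= Phioo.
  by apply/ltW/(Damp_lt_oo Hphi); rewrite addr_ge0 ?bdist_ge0.
apply: le_trans (dphi_triangle HX Hphi (h (L / 2)) x y) _.
by apply: lerD; [apply: (le_trans H1)|apply: (le_trans H2)];
  rewrite ler_wpM2l ?lerD2r ?D.
Qed.

Lemma dphi_lower_bdist x y : Phi (bdist y) - Phi (bdist x) <= dphi phi x y.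
Proof.
apply: le_trans (dphi_lower HX Hphi x y); rewrite lerD2r.
by apply: (Damp_homo Hphi); [exact: bdist_ge0|rewrite metric_sym bdist_lip].
Qed.

Lemma unit_speed_dphi_le L h s t : unit_speed L h -> 0 <= s -> s <= t -> t <= L ->
  dphi phi (h s) (h t) <= t - s.
Proof.
move=> hL s0 st tL; apply: le_trans (unit_speed_dphi HX Hphi hL s0 st tL) _.
apply: (cost_le HX Hphi).
by apply: unit_speed_restr (unit_speed_shift hL s0 (le_trans st tL)) _ _; lra.
Qed.

Lemma Damp_scale t b A : 0 <= t -> 0 <= b -> 1 <= A -> t <= A * b ->
  Phi t <= A * Phi b.
Proof.
move=> t0 b0 A1 tb; have := Damp_concave Hphi (lexx 0) b0 A1.
rewrite (Damp0 (phi := phi)) !subr0 !add0r => H.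
by apply: le_trans (Damp_homo Hphi t0 tb) H.
Qed.

Lemma Damp_sub_le r d : 0 <= r -> 0 <= d -> Phi (r + d) - Phi r <= Phi d.
Proof.
move=> r0 d0; have := Damp_decr Hphi r0 (lexx 0) d0.
by rewrite !addr0 add0r (Damp0 (phi := phi)) subr0.
Qed.

(** * Transport of uniform curves to a target space, later [Omega_phi] *)

Section Push.
Variables (Y : metricType R) (f : X -> Y).
Hypotheses (fd : forall x y, mdist (f x) (f y) = dphi phi x y)
  (fb : forall x, Phi (bdist x) <= bdist (f x)).

(** Each half of the [d]-uniform curve has a majorant built from [K * Phi] of the arc length counted
    from its own end point, and length at most [U * K] times the distance; hence the factor 2. For
    the second condition, a piece of length [s] from the end point has image length at most
    [K * Phi s], and [Phi s <= U * Phi (bdist z)] since [s <= U * bdist z]. *)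
Lemma uniform_push x y : exists (g : R -> Y) (a b : R),
  joins g a b (f x) (f y) /\ uniform_curve (2 * U * john_const C U) g a b.
Proof.
have [L [h [hL h0 hy lL [j1 j2]]]] := uniform_john x y; have L0 := hL.1.
set K := john_const C U; have K0 : 0 <= K by exact: john_const_ge0.
have K1 : 1 <= K by exact: john_const_ge1.
pose g s := f (h s).
have bx := bdist_ge0 ncX x; have by_ := bdist_ge0 ncX y.
have lip s t : 0 <= s -> s <= t -> t <= L -> mdist (g s) (g t) <= t - s.
  by move=> *; rewrite fd (unit_speed_dphi_le hL).
have rect : rectifiable g 0 L.
  by apply: (len_majorant (F := id) L0 _).1.
have left t : 0 <= t -> t <= L / 2 ->
    rectifiable g 0 t /\ len g 0 t <= K * (Phi (bdist x + t) - Phi (bdist x)).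
  move=> t0 tL.
  have [s u s0 su ut|r l] := @len_majorant _ _ g 0 t (fun s => K * Phi (bdist x + s)) t0.
    have := john_dphi HX Hphi U1 j1 s0 su (le_trans ut tL).
    by rewrite fd h0 mulrBr.
  by split=> //; move: l; rewrite addr0 mulrBr.
have right t : L / 2 <= t -> t <= L ->
    rectifiable g t L /\ len g t L <= K * (Phi (bdist y + (L - t)) - Phi (bdist y)).
  move=> tL2 tL.
  have [s u ts su uL|r l] :=
      @len_majorant _ _ g t L (fun s => - (K * Phi (bdist y + (L - s)))) tL.
    have := @john_dphi _ _ _ _ _ HX Hphi _ _ _ (L - u) (L - s) U1 j2.
    rewrite /= !subKr subr0 hy (dphi_sym HX Hphi (h u)) fd => H.
    rewrite opprK addrC -mulrBr; apply: H; lra.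
  split=> //; move: l; rewrite subrr addr0 opprK addrC -mulrBr; exact.
have U0 : 0 <= U by move: U1; lra.
have UK0 : 0 <= U * K by rewrite mulr_ge0.
have Lh0 : 0 <= L / 2 by lra.
have LhL : L / 2 <= L by lra.
have LhU : L / 2 <= U * mdist x y by lra.
(* Since [L / 2 <= U * mdist x y], concavity pulls [U] out of [Phi], and the lower bound of [dphi]
   applies to what remains. *)
have half z : Phi (bdist z + mdist x y) - Phi (bdist z) <= dphi phi x y ->
    K * (Phi (bdist z + L / 2) - Phi (bdist z)) <= U * K * dphi phi x y.
  move=> dz; have bz := bdist_ge0 ncX z.
  rewrite [U * K]mulrC -mulrA; apply: ler_wpM2l => //.
  apply: le_trans (ler_wpM2l U0 dz).
  apply: le_trans (Damp_concave Hphi bz (mdist_ge0 x y) U1).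
  rewrite lerD2r; apply: (Damp_homo Hphi); first by rewrite addr_ge0.
  by rewrite lerD2l.
exists g, 0, L; split; first split.
- split=> //; apply/within_itvP => t tL e e0; exists e => // u uL tu.
  apply: le_lt_trans tu; have /andP[t0 tL'] := tL; have /andP[u0 uL'] := uL.
  case: (leP t u) => tu; first by rewrite distrC (le_trans (lip _ _ _ _ _)) ?ler_norm.
  by rewrite metric_sym (le_trans (lip _ _ _ (ltW tu) _)) ?ler_norm.
- by rewrite /g h0.
- by rewrite /g hy.
split.
  rewrite lenE// lee_fin (lenD Lh0 LhL rect).
  have [_ l1] := left (L / 2) Lh0 (lexx _).
  have [_ l2] := right (L / 2) (lexx _) LhL.
  have E : L - L / 2 = L / 2 by field.
  have E2 : mdist (g 0) (g L) = dphi phi x y by rewrite /g fd h0 hy.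
  rewrite E in l2; rewrite E2.
  have h1 := half x (dphi_lower HX Hphi x y).
  have h2 : K * (Phi (bdist y + L / 2) - Phi (bdist y)) <= U * K * dphi phi x y.
    by apply: half; rewrite metric_sym (dphi_sym HX Hphi); exact: dphi_lower HX Hphi y x.
  apply: (le_trans (lerD (le_trans l1 h1) (le_trans l2 h2))).
  by rewrite -!mulrA -mulr2n mulr_natl.
have bound z s : 0 <= s -> s <= U * bdist z -> K * Phi s <= 2 * U * K * bdist (f z).
  move=> s0 sU; have bz := bdist_ge0 ncX z.
  have H := Damp_scale s0 bz U1 sU.
  apply: (@le_trans _ _ (K * (U * bdist (f z)))).
    by rewrite ler_wpM2l// (le_trans H)// ler_wpM2l ?fb.
  have -> : 2 * U * K * bdist (f z) = K * (U * bdist (f z)) + U * K * bdist (f z) by ring.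
  by rewrite lerDl mulr_ge0//; exact: le_trans (Damp_ge0 Hphi bz) (fb z).
move=> t t0 tL; rewrite ge_min; apply/orP; case: (leP t (L / 2)) => tL2; [left|right].
  have [r l] := left t t0 tL2; rewrite lenE// lee_fin (le_trans l)//.
  have tl : 0 <= t <= L / 2 by rewrite t0.
  apply: le_trans (bound _ _ t0 (j1.2 t tl)).
  by rewrite ler_wpM2l// Damp_sub_le.
have [r l] := right t (ltW tL2) tL; rewrite lenE// lee_fin (le_trans l)//.
have tl : 0 <= L - t <= L / 2 by apply/andP; lra.
have Lt0 : 0 <= L - t by lra.
have := j2.2 _ tl; rewrite subKr => jt.
apply: le_trans (bound _ _ Lt0 jt).
by rewrite ler_wpM2l// Damp_sub_le.
Qed.

End Push.

Lemma unit_speed_ext L g h : unit_speed L h ->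
  (forall s, 0 <= s <= L -> g s = h s) -> unit_speed L g.
Proof.
move=> hL gh; have L0 := hL.1.
have lip s t : 0 <= s -> s <= t -> t <= L -> mdist (g s) (g t) <= t - s.
  move=> s0 st tL; rewrite !gh; first exact: unit_speed_le hL _ _ _.
    by rewrite (le_trans s0).
  by rewrite s0 (le_trans st).
apply: unit_speedP => //.
rewrite -[leLHS]subr0 -(unit_speed_len hL (lexx _) L0 (lexx L)).
apply: (@len_comp _ _ _ _ id _ _ _ _ L0 _ _ _).2 => //.
  by move=> t tL; rewrite gh.
by apply: (len_majorant (F := id) L0 _).1.
Qed.

Hypothesis nbX : ~ metric_bounded [set: X].

Lemma far_point y T : exists z, T <= mdist y z.
Proof.
apply: contrapT => H; apply: nbX; exists (T + T) => a b _ _.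
have near_y z : mdist y z < T.
  by rewrite ltNge; apply/negP => Tz; apply: H; exists z.
rewrite (le_trans (metric_triangle _ y _))// (metric_sym a) lerD// ltW//; exact: near_y.
Qed.

(** Take the first half of a uniform curve to a point at distance at least [2 * T]; that curve has
    length at least [2 * T]. *)
Lemma john_from y T : 0 <= T -> exists2 h, john U T h & h 0 = y.
Proof.
move=> T0; have [z yz] := far_point y (2 * T).
have [L [h [hL h0 hz _ [[_ hJ] _]]]] := uniform_john y z.
have zL : mdist y z <= L.
  by have := unit_speed_le hL (lexx 0) hL.1 (lexx L); rewrite h0 hz subr0.
exists h => //; split; first by apply: unit_speed_restr hL _ _; lra.
by move=> s /andP[s0 sT]; apply: hJ; apply/andP; lra.
Qed.

(** It dominates [4 * U * (1 + U)], the constant that arises when a John curve is appended in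
    [ray_stageS]. *)
Definition ray_const (U : R) := 4 * U * (1 + 2 * U).

Lemma ray_const_ge1 : 1 <= ray_const U.
Proof. by rewrite /ray_const; have := U1; nra. Qed.

(* The factor 2 U at the end point lets the next John curve, of length 2 ^ n, be
   appended without loss in the constant. *)
Let ray_stage x n h := [/\ john (ray_const U) (2 ^+ n) h, h 0 = x &
  2 ^+ n <= 2 * U * bdist (h (2 ^+ n))].

Let ray_stage0 x : exists h, ray_stage x 0 h.
Proof.
have [h [h1 hJ] h0] := john_from x ler01; exists h.
split; rewrite ?expr0//; last first.
  by have := hJ 1; rewrite ler01 lexx => /(_ isT); lra.
split=> // s sl; apply: le_trans (hJ s sl) _.
rewrite ler_wpM2r ?bdist_ge0// /ray_const; have := U1; nra.
Qed.

Let ray_stageS x n h : ray_stage x n h ->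
  exists2 h', ray_stage x n.+1 h' & forall s, s <= 2 ^+ n -> h' s = h s.
Proof.
move=> [[hn hJ] h0 hend]; have T0 : 0 < 2 ^+ n :> R by rewrite exprn_gt0.
set T := 2 ^+ n in T0 hn hJ hend *.
have [k [kT kJ] k0] := john_from (h T) (ltW T0).
have ET : 2 ^+ n.+1 = T + T by rewrite exprS -/T; ring.
exists (curve_cat T h k); last by move=> s sT; rewrite /curve_cat sT.
split; rewrite ?ET.
- split; first exact: unit_speed_cat.
  move=> s /andP[s0 sT]; rewrite /curve_cat; case: (leP s T) => sT'.
    by apply: hJ; rewrite s0.
  set v := s - T; have v0 : 0 <= v <= T by rewrite /v; apply/andP; lra.
  have /andP[v0' vT] := v0.
  have b1 := kJ v v0; have b2 := bdist_lip ncX (k 0) (k v).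
  have := unit_speed_le kT (lexx 0) v0' vT; rewrite subr0 => b3.
  rewrite k0 in b2 b3.
  (* At the junction [T <= 2 * U * bdist (h T)], and [bdist (h T) <= bdist (k v) + v] with
     [v <= U * bdist (k v)]. *)
  have E : T <= 2 * U * (1 + U) * bdist (k v).
    have b4 : bdist (h T) <= (1 + U) * bdist (k v) by rewrite mulrDl mul1r; lra.
    have U20 : 0 <= 2 * U by move: U1; lra.
    by apply: (le_trans hend); rewrite -[leRHS]mulrA; exact: ler_wpM2l.
  have sv : s <= T + T by rewrite /v in vT; lra.
  apply: (le_trans sv); rewrite /ray_const.
  have bk := bdist_ge0 ncX (k v); move: U1 E bk; nra.
- by rewrite /curve_cat (ltW T0).
rewrite /curve_cat; case: (leP (T + T) T) => [TT|_]; first by lra.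
rewrite addrK; have := kJ T; rewrite lexx (ltW T0) => /(_ isT); lra.
Qed.

(** Dependent choice of stages, each extending the previous one. The ray is read off at [s] from
    stage [(Num.truncn s).+1], which reaches [s] because [s <= 2 ^+ (Num.truncn s).+1]. *)
Lemma john_ray x : exists2 h, h 0 = x & forall L, 0 <= L -> john (ray_const U) L h.
Proof.
pose st n := {h | ray_stage x n h}.
pose step n (h : st n) : st n.+1 :=
  let e := cid2 (ray_stageS (svalP h)) in
  exist _ (s2val e) (s2valP e).
have stepE n (h : st n) s : s <= 2 ^+ n -> sval (step n h) s = sval h s.
  exact: (s2valP' (cid2 (ray_stageS (svalP h)))).
pose hs n : st n := nat_rect st (cid (ray_stage0 x)) step n.
have hsE m n s : (n <= m)%N -> s <= 2 ^+ n -> sval (hs m) s = sval (hs n) s.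
  elim: m => [|m ih]; first by rewrite leqn0 => /eqP ->.
  rewrite leq_eqVlt => /predU1P[->//|]; rewrite ltnS => nm sn.
  rewrite -ih// [hs m.+1]/= stepE// (le_trans sn)//.
  by rewrite ler_weXn2l// ler1n.
have le2 s : s <= 2 ^+ (Num.truncn s).+1.
  rewrite (le_trans (ltW (truncnS_gt s)))// -natrX ler_nat.
  exact/ltnW/ltn_expl.
pose h s := sval (hs (Num.truncn s).+1) s.
have hE n s : s <= 2 ^+ n -> h s = sval (hs n) s.
  move=> sn; rewrite /h -(hsE (maxn n (Num.truncn s).+1))// ?leq_maxr//.
  by rewrite (hsE _ n)// leq_maxl.
exists h.
  rewrite (hE 0%N); first by have [] := svalP (hs 0%N).
  by rewrite expr0.
move=> L L0; set n := (Num.truncn L).+1; have Ln : L <= 2 ^+ n by exact: le2.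
have [[hn hJ] _ _] := svalP (hs n).
split.
  apply: unit_speed_ext (unit_speed_restr hn L0 Ln) _ => s /andP[_ sL].
  by rewrite (hE n)// (le_trans sL).
move=> s /andP[s0 sL]; have sn := le_trans sL Ln.
by rewrite (hE n)//; apply: hJ; rewrite s0.
Qed.

End UniformCurves.

(** * Uniform curves given by a Lipschitz parametrization *)

Section LipschitzUniform.
Context {R : realType} {Y : metricType R}.

(** A sufficient condition for a uniform curve in which [K] times the parameter stands in for arc
    length. It is easily reversed, and the length of the curve to infinity need not be computed. *)
Definition lipschitz_uniform (M : R) (y y' : Y) := exists (g : R -> Y) (K b : R),
  [/\ 0 <= b /\ 0 <= K, g 0 = y /\ g b = y',
      forall s t, 0 <= s <= b -> 0 <= t <= b -> mdist (g s) (g t) <= K * `|s - t|,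
      K * b <= M * mdist y y' &
      forall t, 0 <= t <= b -> K * Num.min t (b - t) <= M * bdist (g t)].

Lemma lipschitz_uniform_sym M y y' : lipschitz_uniform M y y' -> lipschitz_uniform M y' y.
Proof.
move=> [g [K [b [[b0 K0] [g0 gb] lip len bd]]]].
exists (fun t => g (b - t)), K, b; split=> //.
- by rewrite subr0 subrr.
- move=> s t /andP[s0 sb] /andP[t0 tb].
  have -> : `|s - t| = `|(b - s) - (b - t)| by rewrite distrC; congr `|_|; ring.
  by apply: lip; apply/andP; lra.
- by rewrite metric_sym.
move=> t /andP[t0 tb].
have -> : Num.min t (b - t) = Num.min (b - t) (b - (b - t)) by rewrite subKr minC.
by apply: bd; apply/andP; lra.
Qed.

Lemma lipschitz_uniform_curve M y y' : lipschitz_uniform M y y' ->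
  exists (g : R -> Y) (a b : R), joins g a b y y' /\ uniform_curve M g a b.
Proof.
move=> [g [K [b [[b0 K0] [g0 gb] lip len bd]]]]; exists g, 0, b.
have lenst s t : 0 <= s -> s <= t -> t <= b ->
    (curve_length g s t <= (K * (t - s))%:E)%E.
  move=> s0 st tb; rewrite mulrBr.
  apply: (@curve_length_majorant _ _ g s t (fun u => K * u)) => p q sp pq qt.
  rewrite -mulrBr -(@ger0_norm _ (q - p)) ?subr_ge0// distrC.
  by apply: lip; apply/andP; lra.
split; first split=> //.
  split=> //; apply/within_itvP => t tb e e0.
  (* [K] may be 0. *)
  have K1 : 0 < K + 1 by lra.
  exists (e / (K + 1)); first by rewrite divr_gt0.
  move=> u ub tu; apply: le_lt_trans (lip _ _ tb ub) _.
  apply: (@le_lt_trans _ _ ((K + 1) * `|t - u|)).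
    by rewrite ler_wpM2r ?normr_ge0//; lra.
  by rewrite mulrC -ltr_pdivlMr.
split.
  by rewrite g0 gb (le_trans (lenst 0 b _ _ _))// subr0 lee_fin.
move=> t t0 tb; have tb' : 0 <= t <= b by rewrite t0.
apply: le_trans (_ : ((K * Num.min t (b - t))%:E <= _)%E); last first.
  by rewrite lee_fin bd.
rewrite minr_pMr// EFin_min ge_min !le_min.
have l1 := lenst 0 t (lexx _) t0 tb; have l2 := lenst t b t0 tb (lexx _).
rewrite subr0 in l1.
case: (leP (K * t) (K * (b - t))) => KK.
  by apply/orP; left; rewrite l1 (le_trans l1)// lee_fin.
by apply/orP; right; rewrite l2 andbT (le_trans l2)// lee_fin ltW.
Qed.

End LipschitzUniform.

(** * Escaping sequences and curves ending at infinity *)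

Section CurvesToInfinity.
Context {R : realType} {X : metricType R} {U : R} {phi : R -> R} {C : R}.
Hypotheses (HX : uniform_domain U X) (Hphi : dampening phi C).
Hypothesis nbX : ~ metric_bounded [set: X].
Local Notation phib := (damp_ext phi).
Local Notation Phi := (Damp (phi := phi)).
Local Notation Phioo := (Dampoo (phi := phi)).
Implicit Types (g h : R -> X) (a b c d s t L M : R) (x y z : X).

Let ncX : ~ seq_complete X. Proof. by case: HX => _ []. Qed.
Let U1 : 1 <= U. Proof. by case: HX => _ []. Qed.

(** Measured by the distance to the boundary: along an unbounded boundary a sequence can leave every
    ball while [bdist] stays bounded, and then it does not approach infinity. *)
Definition escapes (u : nat -> X) :=
  forall M : R, exists N, forall n, (N <= n)%N -> M <= bdist (u n).

Lemma Damp_surj r v : 0 <= r -> 0 <= v -> v < Phioo - Phi r ->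
  exists2 s, 0 <= s & Phi (r + s) - Phi r = v.
Proof.
move=> r0 v0 vr.
have v' : 0 < Phioo - Phi r - v by rewrite subr_gt0.
have [u u0 uP] := Damp_cvg_oo Hphi v'.
have lip p q : 0 <= p -> p <= q -> `|Phi (r + p) - Phi (r + q)| <= `|p - q|.
  move=> p0 pq; have rp0 : 0 <= r + p by rewrite addr_ge0.
  have rpq : r + p <= r + q by rewrite lerD2l.
  rewrite distrC ger0_norm ?subr_ge0 ?(Damp_homo Hphi)//.
  apply: le_trans (Damp_lip Hphi rp0 rpq) _.
  by rewrite opprD addrACA subrr add0r distrC ler_norm.
have cPhi : {within `[0, u], continuous (fun s => Phi (r + s))}.
  apply/within_itv_realP => t /andP[t0 tu] e e0; exists e => // w /andP[w0 wu].
  apply: le_lt_trans; case: (leP t w) => tw; first exact: lip.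
  by rewrite distrC [leRHS]distrC lip// ltW.
have h1 : Phi r <= Phi (r + u) by apply: (Damp_homo Hphi) => //; rewrite lerDl.
have h2 : Phioo - Phi (r + u) < Phioo - Phi r - v by apply: uP; rewrite lerDr.
have mid : Num.min (Phi (r + 0)) (Phi (r + u)) <= Phi r + v <=
    Num.max (Phi (r + 0)) (Phi (r + u)).
  rewrite addr0 min_l// max_r// lerDl v0/=.
  by move: h2; rewrite -addrA -opprD ltrD2l ltrN2 => /ltW.
have [s] := IVT u0 cPhi mid; rewrite in_itv/= => /andP[s0 _] sE.
by exists s => //; rewrite sE addrAC subrr add0r.
Qed.

(** If [u] does not escape, some late [u k] has [bdist] below a fixed bound, and [dphi_sep] at [u k]
    turns the [dphi]-closeness of all later terms into [d]-closeness. *)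
Lemma dichotomy (u : nat -> X) :
  (forall e : R, 0 < e -> exists N, forall m n, (N <= m)%N -> (N <= n)%N ->
     dphi phi (u m) (u n) < e) ->
  cauchy (u @ \oo) \/ escapes u.
Proof.
move=> uC; case: (pselect (escapes u)) => [|nesc]; first by right.
left; have [M MP] : exists M : R, forall N, exists2 n, (N <= n)%N & bdist (u n) < M.
  apply: contrapT => H; apply: nesc => M; apply: contrapT => H'; apply: H.
  exists M => N; apply: contrapT => H; apply: H'; exists N => n Nn.
  by rewrite leNgt; apply/negP => uM; apply: H; exists n.
apply/cauchy_seqP => e e0; have e2 : 0 < e / 2 by rewrite divr_gt0.
have c0 : 0 < phib (M + e / 2) * (e / 2) by rewrite mulr_gt0// (damp_ext_gt0 Hphi).
have [N NP] := uC _ c0; have [k Nk kM] := MP N.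
have close n : (N <= n)%N -> mdist (u k) (u n) < e / 2.
  move=> Nn; rewrite ltNge; apply/negP => far.
  have := NP k n Nk Nn; rewrite ltNge => /negP; apply.
  by apply: le_trans (dphi_sep HX Hphi (ltW e2) (ltW kM) far) _.
exists N => m n Nm Nn; rewrite (le_lt_trans (metric_triangle _ (u k) _))//.
by rewrite metric_sym [ltRHS]splitr ltrD ?close.
Qed.

Lemma escapes_dphi (u v : nat -> X) : escapes u -> escapes v ->
  forall e : R, 0 < e -> exists N, forall m n, (N <= m)%N -> (N <= n)%N ->
    dphi phi (u m) (v n) < e.
Proof.
move=> eu ev e e0; set K := john_const C U.
have K1 : 1 <= K by exact: (john_const_ge1 Hphi).
have K0 : 0 < K by exact: lt_le_trans K1.
have e' : 0 < e / 2 / K by rewrite !divr_gt0.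
have [w w0 wP] := Damp_cvg_oo Hphi e'.
have [N NP] := eu w; have [N' NP'] := ev w.
exists (maxn N N') => m n; rewrite !geq_max => /andP[m1 m2] /andP[n1 n2].
apply: le_lt_trans (dphi_upper HX Hphi (u m) (v n)) _.
have h1 := wP _ (NP _ m1); have h2 := wP _ (NP' _ n2).
rewrite ltr_pdivlMr// in h1; rewrite ltr_pdivlMr// in h2.
rewrite -/K [ltRHS]splitr; apply: ltrD; first by rewrite [K * _]mulrC; exact: h1.
by rewrite [K * _]mulrC; exact: h2.
Qed.

Lemma escaping_ray x : exists2 h, (forall L, 0 <= L -> john (ray_const U) L h) &
  h 0 = x /\ escapes (fun n => h n%:R).
Proof.
have [h h0 hJ] := john_ray HX nbX x; exists h => //; split=> //.
move=> M; have J1 := ray_const_ge1 HX.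
have J0 : 0 < ray_const U by lra.
exists (Num.truncn (ray_const U * M)).+1 => n Nn.
have n0 : 0 <= n%:R :> R by [].
have := (hJ _ n0).2 n%:R; rewrite n0 lexx => /(_ isT) H.
rewrite -(ler_pM2l J0); apply: le_trans H.
by rewrite (le_trans (ltW (truncnS_gt _)))// ler_nat.
Qed.

(** * Transport of rays to a target space in which escaping sequences converge to [w] *)

Section Push.
Variables (Y : metricType R) (f : X -> Y) (w : Y).
Hypotheses (ncY : ~ seq_complete Y)
  (fd : forall x y, mdist (f x) (f y) = dphi phi x y)
  (fb : forall x, Phi (bdist x) <= bdist (f x))
  (fw : forall u, escapes u -> f (u n) @[n --> \oo] --> w).

(** The limit of [dphi_lower_bdist] along an escaping ray. *)
Lemma dphi_lower_oo x : Phioo - Phi (bdist x) <= mdist (f x) w.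
Proof.
have [h _ [_ esc]] := escaping_ray x.
apply/ler_addgt0Pr => e e0; have e2 : 0 < e / 2 by rewrite divr_gt0.
have [u u0 uP] := Damp_cvg_oo Hphi e2.
have [N NP] := esc u; have [N' NP'] := (seq_cvgP _ _).1 (fw esc) _ e2.
set n := maxn N N'; have h1 : u <= bdist (h n%:R) by apply: NP; exact: leq_maxl.
have h2 : mdist w (f (h n%:R)) < e / 2 by apply: NP'; exact: leq_maxr.
have h5 : dphi phi x (h n%:R) <= mdist (f x) w + e / 2.
  rewrite -fd; apply: le_trans (metric_triangle _ w _) _.
  by rewrite lerD2l ltW.
have -> : mdist (f x) w + e = e / 2 + (mdist (f x) w + e / 2).
  by rewrite addrCA -splitr.
have -> : Phioo - Phi (bdist x) =
    (Phioo - Phi (bdist (h n%:R))) + (Phi (bdist (h n%:R)) - Phi (bdist x)).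
  by rewrite addrA subrK.
apply: lerD; first exact/ltW/uP.
exact: le_trans (dphi_lower_bdist HX Hphi x (h n%:R)) h5.
Qed.

Definition infinity_const (C U : R) := john_const C (ray_const U) * ray_const U.

(** The new parameter of the ray is [v = Phi (r + s) - Phi r], with [S] a choice of inverse; it runs
    through [[0, b)], and [john_dphi] says that the image is [K]-Lipschitz in it. The curve is
    closed up by [w] at [v = b], and [dphi_lower_oo] bounds [b] by the distance of the end
    points. *)
Lemma ray_push x : lipschitz_uniform (infinity_const C U) (f x) w.
Proof.
have [h hJ [h0 esc]] := escaping_ray x.
set K := john_const C (ray_const U).
have K1 : 1 <= K by exact: (john_const_ge1 Hphi).
have K0 : 0 <= K by exact: le_trans K1.
have J1 := ray_const_ge1 HX.
have J0 : 0 <= ray_const U by exact: le_trans J1.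
set r := bdist x; have r0 : 0 <= r by exact: bdist_ge0.
set b := Phioo - Phi r; have b0 : 0 < b by rewrite subr_gt0 (Damp_lt_oo Hphi).
have hh s t : 0 <= s -> s <= t ->
    mdist (f (h s)) (f (h t)) <= K * (Phi (r + t) - Phi (r + s)).
  move=> s0 st; have t0 := le_trans s0 st; rewrite fd.
  by have := john_dphi HX Hphi J1 (hJ t t0) s0 st (lexx t); rewrite h0.
have hw s : 0 <= s -> mdist (f (h s)) w <= K * (Phioo - Phi (r + s)).
  move=> s0; apply/ler_addgt0Pr => e e0.
  have [N NP] := (seq_cvgP _ _).1 (fw esc) _ e0.
  set n := maxn N (Num.truncn s).+1.
  have sn : s <= n%:R.
    by rewrite (le_trans (ltW (truncnS_gt s)))// ler_nat leq_maxr.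
  apply: le_trans (metric_triangle _ (f (h n%:R)) _) _.
  rewrite (metric_sym _ w); apply: lerD; last exact/ltW/NP/leq_maxl.
  apply: le_trans (hh _ _ s0 sn) _; rewrite ler_wpM2l// lerD2r ltW// (Damp_lt_oo Hphi)//.
  by rewrite addr_ge0.
pose S v := xget 0 [set s | 0 <= s /\ Phi (r + s) - Phi r = v].
have SP v : 0 <= v -> v < b -> 0 <= S v /\ Phi (r + S v) - Phi r = v.
  move=> v0 vb; have [s s0 sv] := Damp_surj r0 v0 vb.
  by rewrite /S; case: xgetP => [t _ //|/(_ s)]; case.
pose g v := if v < b then f (h (S v)) else w.
have lip s t : 0 <= s -> s <= t -> t <= b -> mdist (g s) (g t) <= K * (t - s).
  move=> s0 st tb; rewrite /g; case: (ltP t b) => tb'.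
    have sb := le_lt_trans st tb'; rewrite sb.
    have [Ss Es] := SP _ s0 sb; have [St Et] := SP _ (le_trans s0 st) tb'.
    have E : t - s = Phi (r + S t) - Phi (r + S s).
      by rewrite -[in LHS]Et -[X in _ - X = _]Es; ring.
    case: (leP (S s) (S t)) => SS; first by rewrite E hh.
    rewrite metric_sym (le_trans (hh _ _ St (ltW SS)))// ler_wpM2l//.
    by rewrite -opprB -E; lra.
  have -> : t = b by apply/eqP; rewrite eq_le tb.
  case: (ltP s b) => sb; last by rewrite mdistxx mulr_ge0// subr_ge0 (le_trans st).
  have [Ss Es] := SP _ s0 sb.
  have -> : b - s = Phioo - Phi (r + S s) by rewrite -[in LHS]Es /b; ring.
  exact: hw.
exists g, K, b; split.
- by split=> //; exact: ltW.
- split; last by rewrite /g ltxx.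
  rewrite /g b0 -h0; apply: mdist_positivity; apply/eqP.
  have [S0 E0] := SP _ (lexx 0) b0.
  rewrite eq_le mdist_ge0 andbT metric_sym (le_trans (hh _ _ (lexx 0) S0))//.
  by rewrite addr0 E0 mulr0.
- move=> s t /andP[s0 sb] /andP[t0 tb]; case: (leP s t) => st.
    by rewrite distrC ger0_norm ?subr_ge0// lip.
  by rewrite metric_sym ger0_norm ?subr_ge0 ?lip// ltW.
- apply: (@le_trans _ _ (K * mdist (f x) w)).
    by rewrite ler_wpM2l// dphi_lower_oo.
  by rewrite ler_wpM2r ?mdist_ge0// /infinity_const ler_peMr.
move=> t /andP[t0 tb].
have M0 : 0 <= infinity_const C U by rewrite mulr_ge0.
move: tb; rewrite le_eqVlt => /predU1P[->|tb].
  rewrite subrr min_r; last exact: ltW.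
  by rewrite mulr0; apply: mulr_ge0 => //; exact: bdist_ge0.
have [S0 E0] := SP _ t0 tb; rewrite /g tb.
(* With [s = S t] one has [t = Phi (r + s) - Phi r <= Phi s <= ray_const U * Phi (bdist (h s))], as
   [s <= ray_const U * bdist (h s)]. *)
apply: (@le_trans _ _ (K * t)).
  by rewrite ler_wpM2l// ge_min lexx.
rewrite /infinity_const -mulrA ler_wpM2l//.
have bh := bdist_ge0 ncX (h (S t)).
apply: (@le_trans _ _ (ray_const U * Phi (bdist (h (S t))))); last first.
  by rewrite ler_wpM2l.
apply: le_trans (Damp_scale Hphi S0 bh J1 _); last first.
  by apply: (hJ _ S0).2; rewrite S0 lexx.
by rewrite -[leLHS]E0; exact: (Damp_sub_le Hphi r0 S0).
Qed.

End Push.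

End CurvesToInfinity.

(** * Limits of distances *)

Section MetricLimits.
Context {R : realType}.

Lemma mdist_cvg {Y : metricType R} (u v : nat -> Y) a b :
  u n @[n --> \oo] --> a -> v n @[n --> \oo] --> b ->
  forall e : R, 0 < e -> exists N, forall n, (N <= n)%N ->
    `|mdist a b - mdist (u n) (v n)| < e.
Proof.
move=> /seq_cvgP ua /seq_cvgP vb e e0; have e2 : 0 < e / 2 by rewrite divr_gt0.
have [N NP] := ua _ e2; have [M MP] := vb _ e2.
exists (maxn N M) => n; rewrite geq_max => /andP[Nn Mn].
rewrite (le_lt_trans (mdist_lip _ _ _ _))// [ltRHS]splitr ltrD//.
  exact: NP.
exact: MP.
Qed.

Lemma mdist_limit_eq {Y Z : metricType R} (u v : nat -> Y) (u' v' : nat -> Z) a b a' b' :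
  u n @[n --> \oo] --> a -> v n @[n --> \oo] --> b ->
  u' n @[n --> \oo] --> a' -> v' n @[n --> \oo] --> b' ->
  (forall n, mdist (u n) (v n) = mdist (u' n) (v' n)) -> mdist a b = mdist a' b'.
Proof.
move=> ua vb ua' vb' E; apply/eqP; rewrite -subr_eq0 -normr_eq0 eq_le normr_ge0 andbT.
apply/ler_addgt0Pr => e e0; rewrite add0r; have e2 : 0 < e / 2 by rewrite divr_gt0.
have [N NP] := mdist_cvg ua vb e2; have [M MP] := mdist_cvg ua' vb' e2.
have h1 := NP (maxn N M) (leq_maxl _ _); have h2 := MP (maxn N M) (leq_maxr _ _).
rewrite -(subrK (mdist (u (maxn N M)) (v (maxn N M))) (mdist a b)) -addrA.
rewrite (le_trans (ler_normD _ _))// [leRHS]splitr lerD//; first exact: ltW.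
by rewrite E distrC ltW.
Qed.

End MetricLimits.

(** * Extension of [dphi] to the completion *)

Section ExtendedDistance.
Context {R : realType} {X : metricType R} {U : R} {phi : R -> R} {C : R}.
Hypotheses (HX : uniform_domain U X) (Hphi : dampening phi C).
Local Notation phib := (damp_ext phi).
Local Notation Phi := (Damp (phi := phi)).
Implicit Types (x y z : X) (p q r : completion X) (u v : nat -> X).

Let ncX : ~ seq_complete X. Proof. by case: HX => _ []. Qed.
Let U1 : 1 <= U. Proof. by case: HX => _ []. Qed.

Lemma dphi_lip x y x' y' :
  `|dphi phi x y - dphi phi x' y'| <= U * mdist x x' + U * mdist y y'.
Proof.
have t x1 y1 x2 y2 : dphi phi x1 y1 - dphi phi x2 y2 <= U * mdist x1 x2 + U * mdist y1 y2.
  rewrite lerBlDr (le_trans (dphi_triangle HX Hphi x2 _ _))// -addrA.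
  apply: lerD; first exact: dphi_le HX Hphi _ _.
  rewrite addrC (metric_sym y1).
  apply: le_trans (dphi_triangle HX Hphi y2 _ _) _; rewrite lerD2l.
  exact: dphi_le HX Hphi _ _.
rewrite ler_norml t andbT lerNl opprB.
by rewrite (metric_sym x) (metric_sym y) t.
Qed.

(** Applied to equal pairs of sequences it is the Cauchy property; applied to different pairs it is
    the independence of the limit from the sequences. *)
Lemma dphi_mix u v u' v' p q :
  embed (u n) @[n --> \oo] --> p -> embed (v n) @[n --> \oo] --> q ->
  embed (u' n) @[n --> \oo] --> p -> embed (v' n) @[n --> \oo] --> q ->
  forall e : R, 0 < e -> exists N, forall m n, (N <= m)%N -> (N <= n)%N ->
    `|dphi phi (u m) (v m) - dphi phi (u' n) (v' n)| < e.
Proof.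
move=> /seq_cvgP up /seq_cvgP vq /seq_cvgP up' /seq_cvgP vq' e e0.
have U0 : 0 < U by apply: lt_le_trans U1.
pose d := e / 4 / U; have d0 : 0 < d by rewrite !divr_gt0.
have [N1 P1] := up _ d0; have [N2 P2] := vq _ d0.
have [N3 P3] := up' _ d0; have [N4 P4] := vq' _ d0.
exists (maxn (maxn N1 N2) (maxn N3 N4)) => m n.
rewrite !geq_max => /andP[/andP[m1 m2] _] /andP[_ /andP[n3 n4]].
apply: le_lt_trans (dphi_lip _ _ _ _) _.
have h1 : mdist (u m) (u' n) < d + d.
  rewrite -mdist_embed (le_lt_trans (metric_triangle _ p _))// ltrD//.
    by rewrite metric_sym P1.
  exact: P3.
have h2 : mdist (v m) (v' n) < d + d.
  rewrite -mdist_embed (le_lt_trans (metric_triangle _ q _))// ltrD//.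
    by rewrite metric_sym P2.
  exact: P4.
have E : e = U * (d + d) + U * (d + d) by rewrite /d; field; rewrite gt_eqF.
by rewrite E ltrD// ltr_pM2l.
Qed.

Let rep p n : X := sval (repr p) n.

Let rep_cvg p : embed (rep p n) @[n --> \oo] --> p.
Proof. by have := @embed_cvg _ _ (repr p); rewrite reprK. Qed.

Definition ext_dphi (phi : R -> R) p q : R :=
  lim (dphi phi (sval (repr p) n) (sval (repr q) n) @[n --> \oo]).

Lemma ext_dphi_cvg : extends_dphi phi (ext_dphi phi).
Proof.
move=> p q u v up vq.
have cv : cvg (dphi phi (rep p n) (rep q n) @[n --> \oo]).
  apply/cauchy_cvgP/cauchy_ballP => e e0.
  have [N NP] := dphi_mix (@rep_cvg p) (@rep_cvg q) (@rep_cvg p)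
    (@rep_cvg q) e0.
  pose I := [set n | (N <= n)%N]; pose d n := dphi phi (rep p n) (rep q n).
  exists (d @` I, d @` I) => /=; first by split; exists N => // n ?; exists n.
  by move=> [_ _] /= [[m Im <-] [n In <-]]; exact: NP.
move: cv; rewrite -/(ext_dphi phi p q) => cv.
have {}cv : dphi phi (rep p n) (rep q n) @[n --> \oo] --> ext_dphi phi p q := cv.
apply/cvgrPdist_lt => e e0; have e2 : 0 < e / 2 by rewrite divr_gt0.
have [N NP] := dphi_mix (@rep_cvg p) (@rep_cvg q) up vq e2.
have /cvgrPdist_lt/(_ _ e2)[M _ MP] := cv.
exists N => // n /= Nn.
have h1 := MP (maxn N M) (leq_maxr _ _).
have h2 := NP (maxn N M) n (leq_maxl _ _) Nn.
rewrite -(subrK (dphi phi (rep p (maxn N M)) (rep q (maxn N M))) (ext_dphi _ _ _)).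
by rewrite -addrA (le_lt_trans (ler_normD _ _))// [ltRHS]splitr ltrD.
Qed.

Let ext_cvg p q := ext_dphi_cvg (@rep_cvg p) (@rep_cvg q).

Lemma ext_dphi_embed x y : ext_dphi phi (embed x) (embed y) = dphi phi x y.
Proof.
have cst z : embed z @[_ --> \oo] --> embed z by exact: cvg_cst.
have c := @ext_dphi_cvg (embed x) (embed y) (fun=> x) (fun=> y) (cst x) (cst y).
by rewrite -(cvg_lim (@Rhausdorff R) c) lim_cst.
Qed.

Lemma ext_dphi_le p q m : (forall e : R, 0 < e -> exists N, forall n, (N <= n)%N ->
    dphi phi (rep p n) (rep q n) <= m + e) -> ext_dphi phi p q <= m.
Proof.
move=> H; apply/ler_addgt0Pr => e e0; have [N NP] := H e e0.
rewrite -(cvg_lim (@Rhausdorff R) (@ext_cvg p q)).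
apply: limr_le; first by apply/cvg_ex; exists (ext_dphi phi p q); exact: (@ext_cvg p q).
by exists N.
Qed.

Lemma ext_dphi_ge u v p q m : embed (u n) @[n --> \oo] --> p ->
  embed (v n) @[n --> \oo] --> q -> (forall e : R, 0 < e ->
    exists N, forall n, (N <= n)%N -> m - e <= dphi phi (u n) (v n)) ->
  m <= ext_dphi phi p q.
Proof.
move=> up vq H; apply/ler_addgt0Pr => e e0; have [N NP] := H e e0.
have c := ext_dphi_cvg up vq.
rewrite -lerBlDr -(cvg_lim (@Rhausdorff R) c).
apply: limr_ge; first by apply/cvg_ex; exists (ext_dphi phi p q); exact: c.
by exists N.
Qed.

Lemma ext_dphi_mdist p q : ext_dphi phi p q <= U * mdist p q.
Proof.
have U0 : 0 < U by apply: lt_le_trans U1.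
apply: ext_dphi_le => e e0; have d0 : 0 < e / U by rewrite divr_gt0.
have [N NP] := mdist_cvg (@rep_cvg p) (@rep_cvg q) d0.
exists N => n Nn; apply: le_trans (dphi_le HX Hphi _ _) _.
have -> : U * mdist p q + e = U * (mdist p q + e / U) by field; rewrite gt_eqF.
rewrite ler_pM2l// -mdist_embed -lerBlDl.
by rewrite (le_trans (ler_norm _))// distrC ltW// NP.
Qed.

(** Along a sequence approaching [p], [bdist] tends to 0, and [dphi_lower_bdist] passes to the
    limit. This is what bounds the distance to the new boundary from below. *)
Lemma ext_dphi_boundary x p : boundary p -> Phi (bdist x) <= ext_dphi phi (embed x) p.
Proof.
move=> pb; have cx : embed x @[_ --> \oo] --> embed x by exact: cvg_cst.
apply: (@ext_dphi_ge (fun=> x) (rep p) _ _ _ cx (@rep_cvg p)).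
move=> e e0; have [N NP] := (seq_cvgP _ _).1 (@rep_cvg p) _ e0.
exists N => n Nn.
apply: le_trans (_ : Phi (bdist x) - Phi (bdist (rep p n)) <= _); last first.
  by rewrite (dphi_sym HX Hphi); exact: dphi_lower_bdist HX Hphi _ _.
rewrite lerD2l lerN2; have b0 := bdist_ge0 ncX (rep p n).
have := Damp_lip Hphi (lexx 0) b0; rewrite (Damp0 (phi := phi)) !subr0 => H.
rewrite (le_trans H)// (le_trans (bdist_le ncX (rep p n) pb))// metric_sym.
exact/ltW/NP.
Qed.

Lemma ext_dphi_ge0 p q : 0 <= ext_dphi phi p q.
Proof.
apply: (ext_dphi_ge (@rep_cvg p) (@rep_cvg q)) => e e0.
exists 0%N => n _; apply: le_trans (dphi_ge0 HX Hphi _ _).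
by rewrite sub0r oppr_le0 ltW.
Qed.

Lemma ext_dphi_positivity p q : ext_dphi phi p q = 0 -> p = q.
Proof.
move=> E; apply: contrapT => /eqP pq; have d0 : 0 < mdist p q by rewrite mdist_gt0.
have d2 : 0 < mdist p q / 2 by rewrite divr_gt0.
have [N NP] := mdist_cvg (@rep_cvg p) (@rep_cvg q) d2.
have [M MP] := cvg_cauchy_seq (@rep_cvg p) ltr01.
(* [B] bounds [bdist] along a tail of the sequence of [p], so [dphi_sep] applies there with a single
   constant. *)
pose B := bdist (rep p M) + 1; set d := mdist p q / 2 in d2 NP.
have c0 : 0 < phib (B + d) * d by rewrite mulr_gt0// (damp_ext_gt0 Hphi).
suff : phib (B + d) * d <= ext_dphi phi p q by rewrite E leNgt c0.
apply: (ext_dphi_ge (@rep_cvg p) (@rep_cvg q)) => e e0.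
exists (maxn N M) => n; rewrite geq_max => /andP[Nn Mn].
apply: le_trans (_ : phib (B + d) * d <= _); first by rewrite gerBl ltW.
set x := rep p n; set y := rep q n.
have bB : bdist x <= B.
  have := bdist_lip ncX x (rep p M); rewrite /B => /le_trans; apply; rewrite lerD2l.
  by rewrite -mdist_embed ltW// MP.
have dxy : d <= mdist x y.
  rewrite -(mdist_embed x y).
  have := NP n Nn; rewrite ltr_norml => /andP[_].
  rewrite /d; set k := mdist (embed x) (embed y); set l := mdist p q; lra.
by apply: le_trans (dphi_sep HX Hphi (ltW d2) bB dxy) _.
Qed.

Lemma ext_dphi_metric : is_metric (ext_dphi phi).
Proof.
split.
- move=> p; apply/eqP; rewrite eq_le ext_dphi_ge0 andbT.
  by have := ext_dphi_mdist p p; rewrite mdistxx mulr0.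
- exact: ext_dphi_positivity.
- by move=> p q; rewrite /ext_dphi; under eq_fun do rewrite (dphi_sym HX Hphi).
move=> q p r; apply: ext_dphi_le => e e0; have e2 : 0 < e / 2 by rewrite divr_gt0.
have /cvgrPdist_lt/(_ _ e2)[N _ NP] := @ext_cvg p q.
have /cvgrPdist_lt/(_ _ e2)[M _ MP] := @ext_cvg q r.
exists (maxn N M) => n; rewrite geq_max => /andP[Nn Mn].
apply: le_trans (dphi_triangle HX Hphi (rep q n) _ _) _.
rewrite [X in _ <= _ + X]splitr addrACA; apply: lerD; rewrite -lerBlDl.
  by rewrite (le_trans (ler_norm _))// distrC ltW// NP.
by rewrite (le_trans (ler_norm _))// distrC ltW// MP.
Qed.

End ExtendedDistance.

(** * The point at infinity, the boundary and the uniformity of [Omega_phi] *)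

Section OmegaPhi.
Context {R : realType} {X : metricType R} {U : R} {phi : R -> R} {C : R}.
Hypotheses (HX : uniform_domain U X) (Hphi : dampening phi C).
Hypothesis nbX : ~ metric_bounded [set: X].
Local Notation Phi := (Damp (phi := phi)).
Local Notation HD := (ext_dphi_metric HX Hphi).
Local Notation Om := (Omega_phi HD).
Local Notation tp := (to_phi HD).
Implicit Types (x y z : X) (p q r : completion X) (u v : nat -> X).

Let ncX : ~ seq_complete X. Proof. by case: HX => _ []. Qed.

Lemma metrized_dist (p q : metrized HD) : mdist p q = ext_dphi phi p q.
Proof. by []. Qed.

Lemma set_val_dist (a b : Om) : mdist (set_val a) (set_val b) = mdist a b.
Proof. by []. Qed.

Lemma set_val_cvg (a : nat -> Om) (l : Om) :
  a n @[n --> \oo] --> l <-> set_val (a n) @[n --> \oo] --> (set_val l : phi_closure HD).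
Proof. by split=> /seq_cvgP H; apply/seq_cvgP => e /H. Qed.

Lemma set_val_notin (a : Om) p : boundary p -> set_val a <> embed (p : metrized HD).
Proof.
move=> pb ap; have := valP a; rewrite inE; apply.
by exists p; rewrite // -ap.
Qed.

Lemma to_phi_dist x y : mdist (tp x) (tp y) = dphi phi x y.
Proof.
rewrite -set_val_dist; have -> : mdist (set_val (tp x)) (set_val (tp y)) =
  mdist (embed (embed x : metrized HD)) (embed (embed y : metrized HD)) by [].
by rewrite mdist_embed metrized_dist (ext_dphi_embed HX Hphi).
Qed.

Lemma to_phi_embed_cvg u p : embed (u n) @[n --> \oo] --> p ->
  set_val (tp (u n)) @[n --> \oo] --> (embed (p : metrized HD) : phi_closure HD).
Proof.
move=> /seq_cvgP up; apply/seq_cvgP => e e0.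
have U0 : 0 < U by case: HX => _ [_ U1 _]; exact: lt_le_trans U1.
have d0 : 0 < e / U by rewrite divr_gt0.
have [N NP] := up _ d0; exists N => n Nn.
have -> : mdist (embed (p : metrized HD)) (set_val (tp (u n))) =
  mdist (embed (p : metrized HD)) (embed (embed (u n) : metrized HD)) by [].
rewrite mdist_embed metrized_dist.
apply: le_lt_trans (ext_dphi_mdist HX Hphi p (embed (u n))) _.
by rewrite mulrC -ltr_pdivlMr// NP.
Qed.

Lemma Omega_phi_not_complete : ~ seq_complete Om.
Proof.
move=> cO; have [p pb] := boundary_nonempty ncX.
have [u uC up] := completion_seq p; have c := to_phi_embed_cvg up.
have [|l tl] := cO (fun n => tp (u n)).
  apply/cauchy_seqP => e /(cvg_cauchy_seq c)[N NP].
  by exists N => m n Nm Nn; exact: NP.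
apply: (set_val_notin (a := l) pb).
by apply: (seq_cvg_unique _ c); exact/set_val_cvg.
Qed.

Lemma infinity_exists : exists infty : Om,
  forall u, escapes u -> tp (u n) @[n --> \oo] --> infty.
Proof.
have [p0 _] := boundary_nonempty ncX; have [x0 _ _] := completion_seq p0.
have [h _ [_ esc]] := escaping_ray HX nbX (x0 0%N).
pose e n : metrized HD := embed (h n%:R).
have eC : cauchy (e @ \oo).
  apply/cauchy_seqP => d /(escapes_dphi HX Hphi esc esc)[N NP].
  by exists N => m n Nm Nn; rewrite metrized_dist (ext_dphi_embed HX Hphi); exact: NP.
have [z ez] := cauchy_embed_cvg eC.
(* By [ext_dphi_boundary] the ray finally stays at distance at least [Phi 1] from every boundary
   point, so its limit is not one of them. *)
have zP : z \in ~` old_boundary (HD := HD).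
  rewrite inE => -[p pb pz].
  have Phi1 : 0 < Phi 1.
    by have := Damp_eq1 Hphi (lexx 0) (@ler01 R); rewrite !add0r (Damp0 (phi := phi)) subr0 => ->.
  have [N NP] := (seq_cvgP _ _).1 ez _ Phi1.
  have [M MP] := esc 1.
  have := NP _ (leq_maxl N M); set n := maxn N M; rewrite -pz mdist_embed metrized_dist.
  have h1 : 1 <= bdist (h n%:R) by apply: MP; exact: leq_maxr.
  have h2 := ext_dphi_boundary HX Hphi (h n%:R) pb.
  have h3 := Damp_homo Hphi ler01 h1.
  rewrite (ismetric_sym HD) => h4.
  by have := lt_le_trans h4 (le_trans h3 h2); rewrite ltxx.
exists (exist _ z zP) => u eu; apply/set_val_cvg/seq_cvgP => d d0.
have d2 : 0 < d / 2 by rewrite divr_gt0.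
have [N NP] := (seq_cvgP _ _).1 ez _ d2.
have [M MP] := escapes_dphi HX Hphi esc eu d2.
exists M => n Mn; have h1 := NP _ (leq_maxl N M).
have h2 := MP _ n (leq_maxr N M) Mn.
apply: le_lt_trans (metric_triangle _ (embed (e (maxn N M))) _) _.
rewrite [ltRHS]splitr; apply: ltrD; first exact: h1.
have -> : mdist (embed (e (maxn N M))) (set_val (tp (u n))) =
  mdist (embed (e (maxn N M))) (embed (embed (u n) : metrized HD)) by [].
by rewrite mdist_embed metrized_dist (ext_dphi_embed HX Hphi).
Qed.

Section Infinity.
Variable infty : Om.
Hypothesis inftyP : forall u, escapes u -> tp (u n) @[n --> \oo] --> infty.

Lemma to_phi_neq_infty x : tp x <> infty.
Proof.
move=> E; have := dphi_lower_oo HX Hphi nbX to_phi_dist inftyP x.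
by rewrite E mdistxx leNgt subr_gt0 (Damp_lt_oo Hphi)// bdist_ge0.
Qed.

Lemma to_phi_dense (a : Om) : exists u, tp (u n) @[n --> \oo] --> a.
Proof.
have H n : exists x, mdist a (tp x) < n.+1%:R^-1.
  have e0 : 0 < n.+1%:R^-1 / 2 :> R by rewrite divr_gt0// invr_gt0.
  have [p pa] := embed_dense (set_val a : completion (metrized HD)) e0.
  have [u _ up] := completion_seq (p : completion X).
  have [N NP] := (seq_cvgP _ _).1 (to_phi_embed_cvg up) _ e0.
  exists (u N); rewrite -set_val_dist [ltRHS]splitr.
  apply: le_lt_trans (metric_triangle _ (embed (p : metrized HD)) _) _.
  by apply: ltrD; [exact: pa|exact: (NP N (leqnn N))].
have [u uP] := choice H; exists u; apply/seq_cvgP => e e0.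
have [N _ NP] := near_infty_natSinv_lt (PosNum e0).
by exists N => n Nn; apply: lt_trans (uP n) (NP _ Nn).
Qed.

Lemma to_phi_cauchy u : cauchy (tp (u n) @[n --> \oo]) <->
  forall e : R, 0 < e -> exists N, forall m n, (N <= m)%N -> (N <= n)%N ->
     dphi phi (u m) (u n) < e.
Proof.
split=> [/cauchy_seqP H e /H[N NP]|H]; last apply/cauchy_seqP => e /H[N NP].
  by exists N => m n Nm Nn; rewrite -to_phi_dist NP.
by exists N => m n Nm Nn; rewrite to_phi_dist NP.
Qed.

(** A sequence of [X] tending to [a] is [dphi]-Cauchy. By [dichotomy] it escapes, and [a] is
    infinity, or it is [d]-Cauchy, and its limit lies in [X] because the boundary has been
    removed. *)
Lemma Omega_phi_cases (a : Om) : a = infty \/ exists x, a = tp x.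
Proof.
have [u ua] := to_phi_dense a.
have uC : cauchy (tp (u n) @[n --> \oo]).
  by apply/cauchy_seqP => e /(cvg_cauchy_seq ua).
have [uX|esc] := dichotomy HX Hphi ((to_phi_cauchy u).1 uC); last first.
  by left; exact: seq_cvg_unique ua (inftyP esc).
right; have [p up] := cauchy_embed_cvg uX.
have c := to_phi_embed_cvg up.
have E : set_val a = embed (p : metrized HD).
  by apply: seq_cvg_unique c; exact/set_val_cvg.
have [|x px] := @boundaryPn _ _ p; first by move=> pb; exact: set_val_notin pb E.
by exists x; apply: val_inj; rewrite /= -px.
Qed.

Lemma escapes_not_cauchy u : escapes u -> ~ cauchy (u @ \oo).
Proof.
move=> esc /cauchy_seqP/(_ 1 ltr01)[N NP].
have [M MP] := esc (bdist (u N) + 1).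
have := MP _ (leq_maxr N M); have := NP _ _ (leq_maxl N M) (leqnn N).
have := bdist_lip ncX (u (maxn N M)) (u N).
set b := bdist (u N); set b' := bdist _; set d := mdist _ _ => h1 h2 h3; lra.
Qed.

Lemma is_infinityP : is_infinity infty.
Proof.
split.
- have [p0 _] := boundary_nonempty ncX; have [x0 _ _] := completion_seq p0.
  have [h _ [_ esc]] := escaping_ray HX nbX (x0 0%N).
  exists (fun n => h n%:R); split; last exact: escapes_not_cauchy.
  by apply/cauchy_seqP => e /(cvg_cauchy_seq (inftyP esc)).
- move=> u uC nuC; apply: inftyP.
  by have [//|] := dichotomy HX Hphi ((to_phi_cauchy u).1 uC).
apply/seteqP; split=> [_ [x _ <-]|a ainf]; first exact: to_phi_neq_infty.
by have [//|[x ->]] := Omega_phi_cases a; exists x.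
Qed.

(** Two sequences of [Omega_phi] with limit [w] have the same limit in [phi_closure], which is
    complete; this defines the canonical map. *)
Let Fex (w : completion Om) : exists q : phi_closure HD,
  forall a : nat -> Om, embed (a n) @[n --> \oo] --> w ->
    set_val (a n) @[n --> \oo] --> q.
Proof.
have [a aC aw] := completion_seq w.
have [|q aq] := @completion_complete _ (metrized HD) (fun n => set_val (a n)).
  by apply/cauchy_seqP => e; move/cauchy_seqP: aC; apply.
exists q => b bw; apply/seq_cvgP => e e0; have e2 : 0 < e / 2 by rewrite divr_gt0.
have e4 : 0 < e / 2 / 2 by rewrite !divr_gt0.
have [N NP] := (seq_cvgP _ _).1 aq _ e2.
have [M MP] := (seq_cvgP _ _).1 aw _ e4.
have [L LP] := (seq_cvgP _ _).1 bw _ e4.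
exists L => n Ln; have h1 := NP _ (leq_maxl N M).
have h2 := MP _ (leq_maxr N M); have h3 := LP _ Ln.
apply: le_lt_trans (metric_triangle _ (set_val (a (maxn N M))) _) _.
rewrite [ltRHS]splitr; apply: ltrD; first exact: h1.
rewrite set_val_dist -mdist_embed [ltRHS]splitr.
apply: le_lt_trans (metric_triangle _ w _) _.
by apply: ltrD; [rewrite metric_sym; exact: h2|exact: h3].
Qed.

Lemma same_boundaryP : same_boundary HD.
Proof.
have [F FP] := choice Fex.
have Fiso w w' : mdist (F w) (F w') = mdist w w'.
  have [a _ aw] := completion_seq w; have [b _ bw] := completion_seq w'.
  apply: mdist_limit_eq (FP _ _ aw) (FP _ _ bw) aw bw _.
  by move=> n; rewrite set_val_dist mdist_embed.
have Fembed (y : Om) : F (embed y) = set_val y.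
  have yy : embed y @[_ --> \oo] --> embed y by exact: cvg_cst.
  have := FP (embed y) (fun=> y) yy => c.
  apply: (@seq_cvg_unique _ _ (fun=> set_val y)) => //; exact: cvg_cst.
have Finj : injective F.
  by move=> w w' E; apply: mdist_positivity; rewrite -Fiso E mdistxx.
(* Off the old boundary [q] is a point of [Omega_phi]; on it, [q] is a limit of points of [X]. *)
have Fsurj (q : phi_closure HD) : exists w, F w = q.
  case: (pselect (old_boundary (HD := HD) q)) => qb; last first.
    have qP : q \in ~` old_boundary (HD := HD) by rewrite inE.
    by exists (embed (exist _ q qP : Om)); rewrite Fembed.
  have [p pb <-] := qb; have [u _ up] := completion_seq (p : completion X).
  have c := to_phi_embed_cvg up.
  have tC : cauchy ((fun n => tp (u n)) @ \oo).
    by apply/cauchy_seqP => e /(cvg_cauchy_seq c)[N NP]; exists N => m n Nm Nn; exact: NP.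
  have [w tw] := cauchy_embed_cvg tC.
  by exists w; apply: seq_cvg_unique (FP _ _ tw) c.
exists F; split=> //.
- have [G GP] := choice Fsurj; exists G => // w; by apply: Finj; rewrite GP.
apply/seteqP; split=> [_ [w wb <-]|q qb].
  apply: contrapT => nb; have qP : F w \in ~` old_boundary (HD := HD) by rewrite inE.
  apply: wb; exists (exist _ (F w) qP : Om) => //.
  by apply: Finj; rewrite Fembed.
have [w wq] := Fsurj q; exists w => // -[y _ yw].
by have := valP y; rewrite inE; apply; rewrite -[val y]/(set_val y) -Fembed yw wq.
Qed.

Lemma bdist_to_phi x : Phi (bdist x) <= bdist (tp x).
Proof.
have [F [_ Fiso Fembed Fb]] := same_boundaryP.
apply: (bdist_ge Omega_phi_not_complete) => w wb.
have [p pb pw] : old_boundary (HD := HD) (F w) by rewrite -Fb; exists w.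
rewrite -(Fiso (embed (tp x)) w)// Fembed -pw.
have -> : mdist (set_val (tp x)) (embed (p : metrized HD)) =
  mdist (embed (embed x : metrized HD)) (embed (p : metrized HD)) by [].
by rewrite mdist_embed metrized_dist; apply: le_trans (ext_dphi_boundary HX Hphi x pb) _.
Qed.

(** The first entry serves pairs of points of [X], the second one pairs that contain infinity. *)
Definition uniformity_const (C U : R) :=
  Num.max (2 * U * john_const C U) (infinity_const C U).

Lemma Omega_phi_uniform : uniform_space (uniformity_const C U) Om.
Proof.
have U1 : 1 <= U by case: HX => _ [].
split; first exact: Omega_phi_not_complete.
  rewrite le_max; apply/orP; right; rewrite mulr_ege1//; last exact: ray_const_ge1 HX.
  exact: (john_const_ge1 Hphi).
have weak M (g : R -> Om) s t : M <= uniformity_const C U -> uniform_curve M g s t ->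
    uniform_curve (uniformity_const C U) g s t.
  move=> MK [h1 h2]; split=> [|v sv vt].
    by apply: (le_trans h1); rewrite lee_fin ler_wpM2r// mdist_ge0.
  apply: (le_trans (h2 v sv vt)); rewrite lee_fin ler_wpM2r//.
  exact: (bdist_ge0 Omega_phi_not_complete).
have K1 : 2 * U * john_const C U <= uniformity_const C U by rewrite le_max lexx.
have K2 : infinity_const C U <= uniformity_const C U by rewrite le_max lexx orbT.
have ray x := ray_push HX Hphi nbX Omega_phi_not_complete to_phi_dist bdist_to_phi inftyP x.
move=> a b ab; have [ainf|[x ax]] := Omega_phi_cases a.
  have [binf|[y b_y]] := Omega_phi_cases b; first by exfalso; apply: ab; rewrite ainf.
  have [g [s [t [gj gu]]]] := lipschitz_uniform_curve (lipschitz_uniform_sym (ray y)).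
  by exists g, s, t; rewrite ainf b_y; split=> //; exact: weak K2 _.
have [binf|[y b_y]] := Omega_phi_cases b.
  have [g [s [t [gj gu]]]] := lipschitz_uniform_curve (ray x).
  by exists g, s, t; rewrite ax binf; split=> //; exact: weak K2 _.
have [g [s [t [gj gu]]]] := uniform_push HX Hphi to_phi_dist bdist_to_phi x y.
by exists g, s, t; rewrite ax b_y; split=> //; exact: weak K1 _.
Qed.

End Infinity.

End OmegaPhi.

(** * Limits along ultrafilters *)

Section UltraLimits.
Context {R : realType} {Y : metricType R}.

Lemma filter_cvgP {T} (F : set_system T) {FF : Filter F} (f : T -> Y) (l : Y) :
  f @ F --> l <-> forall e : R, 0 < e -> F [set y | mdist l (f y) < e].
Proof.
by split=> [/metricType_numDomainType.cvgrPdist_lt//|?];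
  exact/metricType_numDomainType.cvgrPdist_lt.
Qed.

Lemma ultra_fmap {T S} (F : set_system T) (f : T -> S) :
  UltraFilter F -> UltraFilter (f @ F).
Proof.
move=> FU; split; first exact: fmap_proper_filter.
move=> G PG FG; apply/seteqP; split=> // A GA.
have [//|nA] := in_ultra_setVsetC (f @^-1` A) FU.
have GnA : G (~` A) by exact: FG.
by have [y []] := filter_ex (filterI GA GnA).
Qed.

End UltraLimits.

(** * Compactness away from a bounded boundary *)

Section LocalCompactness.
Context {R : realType} {X : metricType R} {U : R}.
Hypothesis HX : uniform_domain U X.
Implicit Types (x y : X).

Let ncX : ~ seq_complete X. Proof. by case: HX => _ []. Qed.
Let U1 : 1 <= U. Proof. by case: HX => _ []. Qed.

(* An ultrafilter on the annulus is pushed along uniform curves issued from a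
   base point: the set of the times t at which the pushed ultrafilter converges
   is open by local compactness, and closed because the curves stay away from
   the boundary. *)
Lemma annulus_compact (M N : R) : 0 < M -> metric_bounded (@boundary R X) ->
  compact [set x : X | M <= bdist x <= N].
Proof.
move=> M0 [D bD]; rewrite compact_ultra => F FU FE; set E := [set x | _] in FE.
have [z0 z0b] := boundary_nonempty ncX.
have [u0 _ _] := completion_seq z0; pose x0 := u0 0%N.
have /choice[L /choice[h hP]] := uniform_unit_speed HX x0.
(* A point [y] of the annulus is reached from [x0] through [z0] and a boundary point at distance
   less than [N + 1] from [y]; [T] then bounds the lengths of all the curves. *)
pose rho := mdist (embed x0) z0 + D + (N + 1); pose T := U * rho.
have x0E y : E y -> mdist x0 y <= rho.
  move=> /andP[_ yN]; have [z zb yz] := bdist_near ncX y ltr01.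
  rewrite -mdist_embed (le_trans (metric_triangle _ z _))//.
  apply: lerD; last by rewrite metric_sym ltW// (lt_le_trans yz)// lerD2r.
  by rewrite (le_trans (metric_triangle _ z0 _))// lerD2l bD.
(* The curve rests at [y] after its end, so it is defined for all times and has arrived at time
   [T]. *)
pose G t y := h y (Num.min t (L y)).
have GE t y : 0 <= t -> 0 <= Num.min t (L y) <= L y.
  by move=> t0; have [[L0 _] _ _ _ _] := hP y; rewrite le_min t0 L0 ge_min lexx orbT.
have Glip s t y : 0 <= s -> 0 <= t -> mdist (G s y) (G t y) <= `|s - t|.
  move=> s0 t0; have [hy _ _ _ _] := hP y.
  apply: le_trans (unit_speed_lip hy (GE _ _ s0) (GE _ _ t0)) _.
  case: (leP s (L y)) => sL; case: (leP t (L y)) => tL //.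
  - by rewrite distrC [leRHS]distrC !ger0_norm; lra.
  - by rewrite !ger0_norm; lra.
  - by rewrite subrr normr0.
(* A point whose nearer end is at arc length [m] has [m <= U * bdist], while [bdist] at that end is
   at least the minimum and at most [bdist + m]; hence the divisor [U + 1]. *)
pose c := Num.min (bdist x0) M / (U + 1).
have bx0 : 0 < bdist x0 by apply: bdist_gt0 => //; case: HX.
have U10 : 0 < U + 1 by move: U1; lra.
have c0 : 0 < c by rewrite divr_gt0// lt_min bx0.
have Gc t y : 0 <= t -> E y -> c <= bdist (G t y).
  move=> t0 /andP[My _]; have [hy h0 hL _ hU] := hP y.
  have sL := GE t y t0; rewrite /G; set s := Num.min t (L y) in sL *.
  have /andP[s0 sLy] := sL; have := hU _ sL.
  have := unit_speed_le hy (lexx 0) s0 sLy; rewrite subr0 h0.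
  have := unit_speed_le hy s0 sLy (lexx _); rewrite hL.
  have := bdist_lip ncX x0 (h y s); have := bdist_lip ncX y (h y s).
  rewrite (metric_sym y) /c ler_pdivrMr//.
  have : Num.min (bdist x0) M <= bdist x0 by rewrite ge_min lexx.
  have : Num.min (bdist x0) M <= M by rewrite ge_min lexx orbT.
  case: (leP s (L y - s)) => _; lra.
have GT y : E y -> G T y = y.
  move=> Ey; have [_ _ hL LU _] := hP y; rewrite /G min_r ?hL//.
  rewrite (le_trans LU)// ler_wpM2l ?x0E//; move: U1; lra.
pose S := [set t : R | 0 <= t /\ exists p : X, G t y @[y --> F] --> p].
have S0 : S 0.
  split=> //; exists x0; apply/filter_cvgP => e e0.
  apply: filterE => y /=; have [[L0 _] h0 _ _ _] := hP y.
  by rewrite /G min_l// h0 mdistxx.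
have Sopen t : S t -> exists2 t', t < t' & forall s, t <= s -> s <= t' -> S s.
  move=> [t0 [p tp]]; have [W + [cW _]] := HX.1 p I.
  move=> /metric_nbhsP[d d0 dW]; have d2 : 0 < d / 2 by rewrite divr_gt0.
  exists (t + d / 2); first by rewrite ltrDl.
  move=> s ts st; have s0 := le_trans t0 ts; split=> //.
  have FW : F (G s @^-1` W).
    apply: filterS ((filter_cvgP _ _).1 tp _ d2) => y /= tyd.
    apply: dW => //; apply: le_lt_trans (metric_triangle _ (G t y) _) _.
    rewrite [ltRHS]splitr ltr_leD// (le_trans (Glip _ _ _ t0 s0))//.
    by rewrite distrC ger0_norm ?subr_ge0// lerBlDl.
  move: cW; rewrite compact_ultra => cW.
  by have [q [_ sq]] := cW _ (ultra_fmap (G s) FU) FW; exists q.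
have Sclosed t : 0 <= t -> (forall e, 0 < e -> exists2 s, S s & `|s - t| < e) -> S t.
  move=> t0 tS.
  have sn n : exists s, S s /\ `|s - t| < n.+1%:R^-1.
    have [|s Ss st] := tS n.+1%:R^-1; first by rewrite invr_gt0.
    by exists s.
  have [s sP] := choice sn.
  have [p pP] := choice (fun n => (sP n).1.2).
  have s0 n : 0 <= s n by exact: (sP n).1.1.
  have small (e : R) : 0 < e -> exists K, forall n, (K <= n)%N -> `|s n - t| < e.
    move=> e0; have [K _ KP] := near_infty_natSinv_lt (PosNum e0).
    by exists K => n Kn; apply: lt_trans (sP n).2 (KP n Kn).
  have near_p n (e : R) : 0 < e -> exists2 A, F A & forall y, A y ->
      E y /\ mdist (p n) (G (s n) y) < e.
    move=> e0; have /filter_cvgP/(_ _ e0) pn := pP n.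
    by exists (E `&` [set y | mdist (p n) (G (s n) y) < e]) => [|y []//]; exact: filterI.
  have pc n : c <= bdist (p n).
    apply/ler_addgt0Pr => e e0; have [A FA AP] := near_p n e e0.
    have [y Ay] := filter_ex FA; have [Ey py] := AP y Ay.
    rewrite (le_trans (Gc (s n) y (s0 n) Ey))//.
    rewrite (le_trans (bdist_lip ncX _ (p n)))// lerD2l metric_sym.
    exact: ltW.
  (* Two limits [p m] and [p n] are compared through one [y], which exists because members of [F]
     meet. *)
  have pC : cauchy (p @ \oo).
    apply/cauchy_seqP => e e0; have e4 : 0 < e / 2 / 2 by rewrite !divr_gt0.
    have [K KP] := small _ e4; exists K => m n Km Kn.
    have [A FA AP] := near_p m _ e4; have [B FB BP] := near_p n _ e4.
    have [y [Ay By]] := filter_ex (filterI FA FB).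
    have [_ h1] := AP y Ay; have [_ h2] := BP y By.
    have h3 := Glip _ _ y (s0 m) (s0 n).
    have h4 : `|s m - s n| <= `|s m - t| + `|s n - t|.
      by rewrite (distrC (s n)) ler_distD.
    have h5 := KP m Km; have h6 := KP n Kn.
    apply: le_lt_trans (metric_triangle _ (G (s m) y) _) _.
    have := metric_triangle (G (s m) y) (G (s n) y) (p n).
    rewrite (metric_sym (G (s n) y) (p n)) => h7; lra.
  have [z pz] := cauchy_embed_cvg pC.
  (* The limit is no boundary point, as [bdist (p n)] stays above [c]. *)
  have [|q zq] := @boundaryPn _ _ z.
    move=> zb; have [K KP] := (seq_cvgP _ _).1 pz _ c0.
    have := KP K (leqnn _); rewrite ltNge metric_sym => /negP; apply.
    exact: le_trans (pc K) (bdist_le ncX (p K) zb).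
  have pq : p n @[n --> \oo] --> q by apply/embed_seq_cvg; rewrite -zq.
  split=> //; exists q; apply/filter_cvgP => e e0.
  have e3 : 0 < e / 3 by rewrite divr_gt0.
  have [K1 KP1] := small _ e3; have [K2 KP2] := (seq_cvgP _ _).1 pq _ e3.
  set n := maxn K1 K2; have [A FA AP] := near_p n _ e3.
  apply: filterS FA => y /AP[_ h1] /=.
  have h2 := KP1 n (leq_maxl _ _); have h3 := KP2 n (leq_maxr _ _).
  have h4 := Glip _ _ y (s0 n) t0.
  apply: le_lt_trans (metric_triangle _ (p n) _) _.
  have := metric_triangle (p n) (G (s n) y) (G t y); lra.
(* [Sopen] extends to the right only, so the supremum is taken over the initial segments contained
   in [S]. *)
have Sall t : 0 <= t -> S t.
  move=> t0; apply: contrapT => nSt.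
  pose A := [set s | 0 <= s /\ forall r, 0 <= r -> r <= s -> S r].
  have A0 : A 0 by split=> // r r0 r1; have -> : r = 0 by lra.
  have Ab s : A s -> s <= t.
    by move=> [s0 sS]; rewrite leNgt; apply/negP => /ltW ts; apply: nSt; exact: sS.
  have supA : has_sup A by split; [exists 0|exists t].
  set b := sup A; have b0 : 0 <= b by apply: (sup_ubound supA.2).
  have below r : 0 <= r -> r < b -> S r.
    by move=> r0 /(sup_gt (ex_intro _ _ A0))[s [_ sS] rs]; apply: sS => //; exact: ltW.
  have Sb : S b.
    apply: Sclosed => // e e0; move: b0; rewrite le_eqVlt => /predU1P[<-|b0].
      by exists 0; rewrite // subrr normr0.
    exists (Num.max 0 (b - e / 2)).
      by apply: below; rewrite ?le_max ?lexx// gt_max b0/=; lra.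
    have : Num.max 0 (b - e / 2) <= b by rewrite ge_max (ltW b0)/=; lra.
    have : b - e / 2 <= Num.max 0 (b - e / 2) by rewrite le_max lexx orbT.
    set m := Num.max _ _ => h1 h2.
    by rewrite distrC ger0_norm; lra.
  have [b' bb' b'S] := Sopen b Sb.
  have : A b'.
    split=> [|r r0 rb']; first by rewrite (le_trans b0)// ltW.
    case: (ltP r b) => rb; first exact: below.
    exact: b'S.
  by move=> /(sup_ubound supA.2); rewrite leNgt bb'.
have T0 : 0 <= T.
  have [y Ey] := filter_ex FE; rewrite mulr_ge0//; first by move: U1; lra.
  exact: le_trans (mdist_ge0 _ _) (x0E y Ey).
(* At time [T] the pushed ultrafilter is [F] itself. *)
have [_ [p Tp]] := Sall T T0.
have Fp (e : R) : 0 < e -> F [set y | E y /\ mdist p y < e].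
  move=> e0; have /filter_cvgP/(_ _ e0) Tpe := Tp.
  by apply: filterS (filterI FE Tpe) => y [Ey /=]; rewrite GT.
exists p; split.
  apply/andP; split; apply/ler_addgt0Pr => e e0; have [y [/andP[My yN] py]] := filter_ex (Fp e e0).
    by have := bdist_lip ncX y p; rewrite metric_sym; move: My py; set d := mdist p y; lra.
  by have := bdist_lip ncX p y; move: yN py; set d := mdist p y; lra.
by apply/metricType_numDomainType.fcvgrPdist_lt => e /Fp; apply: filterS => y [].
Qed.

End LocalCompactness.

(** * The identity map, and local compactness of [Omega_phi] *)

Section IdentityMap.
Context {R : realType} {X : metricType R} {U : R} {phi : R -> R} {C : R}.
Hypotheses (HX : uniform_domain U X) (Hphi : dampening phi C).
Local Notation phib := (damp_ext phi).
Local Notation Phi := (Damp (phi := phi)).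
Local Notation Phioo := (Dampoo (phi := phi)).
Local Notation HD := (ext_dphi_metric HX Hphi).
Local Notation Om := (Omega_phi HD).
Local Notation tp := (to_phi HD).
Implicit Types (x y z : X).

Let ncX : ~ seq_complete X. Proof. by case: HX => _ []. Qed.
Let U1 : 1 <= U. Proof. by case: HX => _ []. Qed.

Lemma bilipschitz_onP (A : set X) (c : R) : 0 < c ->
  (forall y z, A y -> A z -> c * mdist y z <= dphi phi y z) ->
  bilipschitz_on (Num.max U c^-1) A tp.
Proof.
move=> c0 cA y z Ay Az; rewrite to_phi_dist; apply/andP; split.
  apply: le_trans (cA y z Ay Az); apply: ler_wpM2r; first exact: mdist_ge0.
  rewrite -[leRHS]invrK lef_pV2 ?posrE ?invr_gt0// ?le_max ?lexx ?orbT//.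
  by rewrite lt_max invr_gt0 c0 orbT.
apply: le_trans (dphi_le HX Hphi y z) _; apply: ler_wpM2r; first exact: mdist_ge0.
by rewrite le_max lexx.
Qed.

Lemma to_phi_locally_bilipschitz : locally_bilipschitz tp.
Proof.
move=> x; exists [set y | mdist x y < 1]; split.
  by apply/metric_nbhsP; exists 1.
(* In the unit ball about [x], [bdist] is at most [bdist x + 1] and distances are at most 2. *)
pose c := phib (bdist x + 1 + 2); have c0 : 0 < c by exact: (damp_ext_gt0 Hphi).
exists (Num.max U c^-1); split; first by rewrite le_max U1.
apply: bilipschitz_onP => // y z /= xy xz.
have yz : mdist y z <= 2.
  have := metric_triangle y x z; rewrite (metric_sym y x).
  by move: (mdist x y) (mdist x z) (mdist y z) xy xz => a b d; lra.
have yx : bdist y <= bdist x + 1.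
  rewrite (le_trans (bdist_lip ncX y x))// lerD2l metric_sym; exact: ltW.
apply: le_trans (dphi_sep HX Hphi (mdist_ge0 y z) yx (lexx _)).
apply: ler_wpM2r; first exact: mdist_ge0.
by apply: (damp_ext_mono Hphi); rewrite lerD2l.
Qed.

(* Both points are so close to the boundary that phi is 1 along the way. *)
Lemma dphi_ge_mdist (z : completion X) x y : boundary z ->
  near_bdpoint 4^-1 z x -> near_bdpoint 4^-1 z y -> mdist x y <= dphi phi x y.
Proof.
rewrite /near_bdpoint/= => zb xz yz.
(* The radius [4^-1] keeps [bdist x + mdist x y] at most 3/4, inside the range where [phi] is 1. *)
have bx : bdist x <= 4^-1 by apply: le_trans (bdist_le ncX x zb) (ltW xz).
have xy : mdist x y <= 4^-1 + 4^-1.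
  rewrite -mdist_embed (le_trans (metric_triangle _ z _))//.
  by apply: lerD; [exact: ltW|rewrite metric_sym; exact: ltW].
rewrite -[leLHS](Damp_eq1 Hphi (bdist_ge0 ncX x) (mdist_ge0 x y)).
  exact: dphi_lower HX Hphi x y.
by move: (bdist x) (mdist x y) bx xy => a b; lra.
Qed.

Lemma to_phi_bilipschitz_near_boundary : bilipschitz_near_boundary tp.
Proof.
exists 4^-1, (Num.max U 1^-1); split; first by rewrite invr_gt0.
  by rewrite le_max U1.
move=> z zb; apply: bilipschitz_onP => // x y xz yz.
by rewrite mul1r (dphi_ge_mdist zb).
Qed.

Lemma dphi_le_length_space x y : length_space X -> dphi phi x y <= mdist x y.
Proof.
move=> lX; apply/ler_addgt0Pr => e e0.
have : (ereal_inf [set l | exists (g : R -> X) (a b : R),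
    joins g a b x y /\ l = curve_length g a b] < (mdist x y + e)%:E)%E.
  by rewrite -lX lte_fin ltrDl.
move=> /ereal_inf_lt[_ [g [a [b [[gc ga gb] ->]]]] gl].
have gr : rectifiable g a b by apply: lt_trans gl (ltry _).
have [hL h0 hg] := unit_speed_arc_length gc gr.
have := dphi_le_cost HX Hphi hL; rewrite h0 hg ?lexx ?gc.1// ga gb => /le_trans; apply.
apply: le_trans (cost_le HX Hphi hL) _.
by rewrite -lee_fin -lenE ?gc.1// ltW.
Qed.

Lemma to_phi_isometry_near_boundary : length_space X -> isometry_near_boundary tp.
Proof.
move=> lX; exists 4^-1; split; first by rewrite invr_gt0.
move=> z zb x y xz yz; rewrite to_phi_dist; apply/eqP; rewrite eq_le.
by apply/andP; split; [exact: dphi_le_length_space|exact: dphi_ge_mdist zb xz yz].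
Qed.

Lemma to_phi_compact (W : set X) : compact W -> compact (tp @` W).
Proof.
move=> cW; apply: continuous_compact => //; apply: continuous_subspaceT => x.
apply/metricType_numDomainType.cvgrPdist_lt => e e0; apply/metric_nbhsP.
have U0 : 0 < U by exact: lt_le_trans U1.
exists (e / U); first by rewrite divr_gt0.
move=> y xy; rewrite to_phi_dist; apply: le_lt_trans (dphi_le HX Hphi x y) _.
by rewrite mulrC -ltr_pdivlMr.
Qed.

Hypothesis nbX : ~ metric_bounded [set: X].
Variable infty : Om.
Hypothesis inftyP : forall u, escapes u -> tp (u n) @[n --> \oo] --> infty.

(** A ball that misses infinity and is small enough for [dphi_sep] lies in the image of a [d]-ball
    contained in a compact set. *)
Lemma compact_near_to_phi x : compact_near (nbhs (tp x)).
Proof.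
have [W + [cW _]] := HX.1 x I; move=> /metric_nbhsP[e e0 eW].
exists (tp @` W); last first.
  split; first exact: to_phi_compact.
  by apply: compact_closed; [exact: metric_hausdorff|exact: to_phi_compact].
have [d d0 dinf] : exists2 d : R, 0 < d & d <= mdist (tp x) infty.
  exists (mdist (tp x) infty) => //; rewrite mdist_gt0; apply/eqP.
  exact: to_phi_neq_infty nbX _ inftyP _.
have c0 : 0 < phib (bdist x + e) * e by rewrite mulr_gt0 ?(damp_ext_gt0 Hphi).
apply/metric_nbhsP; exists (Num.min d (phib (bdist x + e) * e)).
  by rewrite lt_min d0.
move=> a; rewrite lt_min => /andP[ad ac].
have [ainf|[y ay]] := Omega_phi_cases inftyP a.
  by move: ad; rewrite ainf ltNge dinf.
exists y => //; apply: eW => //; rewrite ltNge; apply/negP => exy.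
move: ac; rewrite ay to_phi_dist ltNge => /negP; apply.
by apply: le_trans (dphi_sep HX Hphi (ltW e0) (lexx _) exy) _.
Qed.

Lemma locally_compact_finite_part : locally_compact (~` [set infty]).
Proof.
move=> a ainf; have [//|[x ->]] := Omega_phi_cases inftyP a.
have [W xW cW] := compact_near_to_phi x; exists W => //.
by apply: filterS xW => b Wb _.
Qed.

(** An ultrafilter on a closed ball about infinity converges to infinity or avoids a smaller ball;
    in the latter case it lives on the image of a compact annulus. *)
Lemma compact_near_infty : metric_bounded (@boundary R X) -> compact_near (nbhs infty).
Proof.
(* Where [bdist x < 1], the distance to infinity is at least [Phioo - Phi 1], twice [d]; so [N]
   meets [X] only where [bdist] is at least 1. *)
move=> bdX; pose d := (Phioo - Phi 1) / 2.
have P1 : 0 < Phioo - Phi 1 by rewrite subr_gt0 (Damp_lt_oo Hphi).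
have d0 : 0 < d by rewrite divr_gt0.
pose N := [set a : Om | mdist infty a <= d].
have inN x : N (tp x) -> 1 <= bdist x.
  move=> /= xd; rewrite leNgt; apply/negP => x1.
  have h1 := dphi_lower_oo HX Hphi nbX (to_phi_dist HX Hphi) inftyP x.
  have h2 := Damp_homo Hphi (bdist_ge0 ncX x) (ltW x1).
  have : Phioo - Phi 1 <= d.
    by apply: le_trans xd; rewrite metric_sym; apply: le_trans h1; rewrite lerD2l lerN2.
  by rewrite /d; move: (Phioo - Phi 1) P1 => v; lra.
have clN : closed N.
  move=> a aN; apply/ler_addgt0Pr => e e0.
  have nb : nbhs a [set b | mdist a b < e] by apply/metric_nbhsP; exists e.
  have [b [bN ab]] := aN _ nb.
  apply: le_trans (metric_triangle _ b _) _.
  by apply: lerD; [exact: bN|rewrite metric_sym; exact: ltW ab].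
exists N.
  by apply/metric_nbhsP; exists d => // a ad; exact: ltW.
split=> //; rewrite compact_ultra => F FU FN.
have [Finf|nFinf] := pselect (F --> infty).
  by exists infty; split=> //; rewrite /N/= mdistxx ltW.
have [e e0 nFe] : exists2 e : R, 0 < e & ~ F [set a | mdist infty a < e].
  apply: contrapT => H; apply: nFinf.
  apply/metricType_numDomainType.fcvgrPdist_lt => e e0.
  by apply: contrapT => H'; apply: H; exists e.
have Fe : F (~` [set a | mdist infty a < e]) by have [//|] := in_ultra_setVsetC [set a | mdist infty a < e] FU.
(* Otherwise some escaping sequence would keep distance at least [e] from infinity. *)
have [M MP] : exists M : R, forall x, e <= mdist infty (tp x) -> bdist x <= M.
  apply: contrapT => H.
  have /choice[u uP] n : exists x, e <= mdist infty (tp x) /\ n%:R < bdist x.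
    apply: contrapT => H'; apply: H; exists n%:R => x ex; rewrite leNgt.
    by apply/negP => nx; apply: H'; exists x.
  have eu : escapes u.
    move=> M; exists (Num.truncn M).+1 => n Mn.
    rewrite (le_trans _ (ltW (uP n).2))// (le_trans (ltW (truncnS_gt M)))//.
    by rewrite ler_nat.
  have [K KP] := (seq_cvgP _ _).1 (inftyP eu) _ e0.
  by have := KP K (leqnn K); rewrite ltNge (uP K).1.
have cE := to_phi_compact (annulus_compact HX (N := M) ltr01 bdX).
rewrite compact_ultra in cE.
have [|p [_ Fp]] := cE F FU.
  apply: filterS (filterI FN Fe) => a [Na /= ea].
  have [ainf|[x ax]] := Omega_phi_cases inftyP a.
    by exfalso; apply: ea; rewrite ainf mdistxx.
  exists x => //; rewrite ax in Na ea; rewrite /= inN//=; apply: MP.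
  by rewrite leNgt; apply/negP.
exists p; split=> //.
apply: clN => B pB; have FB : F B by exact: Fp.
by have [b NBb] := filter_ex (filterI FN FB); exists b.
Qed.

Lemma locally_compact_Omega_phi : metric_bounded (@boundary R X) ->
  locally_compact [set: Om].
Proof.
move=> bdX a _.
have [W aW cW] : compact_near (nbhs a).
  by have [->|[x ->]] := Omega_phi_cases inftyP a;
    [exact: compact_near_infty|exact: compact_near_to_phi].
by exists W => //; apply: filterS aW => b Wb _.
Qed.

End IdentityMap.

(* Local compactness of Omega_phi at infty is asserted only for a bounded
   boundary: it fails in the upper half plane with phi(t) = min(1, t^-2), where
   the points (n, M), n in nat, have a common arbitrarily small distance to
   infty and mutual distances bounded below. *)
Theorem theorem1p1 (R : realType) :
  exists K : R -> R -> R,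
  forall (Omega : metricType R) (C_U : R) (phi : R -> R) (C_phi : R),
    ~ metric_bounded [set: Omega] ->
    uniform_domain C_U Omega ->
    subcurve_uniform C_U Omega ->
    dampening phi C_phi ->
    exists (D : completion Omega -> completion Omega -> R)
           (HD : is_metric D) (infty : Omega_phi HD),
      extends_dphi phi D /\
      is_infinity infty /\
      uniform_space (K C_phi C_U) (Omega_phi HD) /\
      locally_compact (~` [set infty]) /\
      (metric_bounded (@boundary R Omega) ->
        uniform_domain (K C_phi C_U) (Omega_phi HD)) /\
      same_boundary HD /\
      locally_bilipschitz (to_phi HD) /\
      bilipschitz_near_boundary (to_phi HD) /\
      (length_space Omega -> isometry_near_boundary (to_phi HD)).
Proof.
exists uniformity_const => Omega C_U phi C_phi nbO HO _ Hphi.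
have [infty inftyP] := infinity_exists HO Hphi nbO.
exists (ext_dphi phi), (ext_dphi_metric HO Hphi), infty.
split; first exact: ext_dphi_cvg HO Hphi.
split; first exact: is_infinityP nbO _ inftyP.
split; first exact: Omega_phi_uniform nbO _ inftyP.
split; first exact: locally_compact_finite_part nbO _ inftyP.
split.
  move=> bdO; split; last exact: Omega_phi_uniform nbO _ inftyP.
  exact: locally_compact_Omega_phi nbO _ inftyP bdO.
split; first exact: same_boundaryP.
split; first exact: to_phi_locally_bilipschitz.
split; first exact: to_phi_bilipschitz_near_boundary.
exact: to_phi_isometry_near_boundary.
Qed.
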